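(* Let $\Bbbk$ be an algebraically closed field, and let $\mathcal{C}$ and $\mathcal{C}'$ be two non-semisimple finite tensor categories over $\Bbbk$. Suppose $F:\mathcal{C}\to\mathcal{C}'$ is an exact $\Bbbk$-linear monoidal functor inducing a stable equivalence $\underline{F}:\underline{\mathcal{C}}\to\underline{\mathcal{C}'}$. If all simple objects in $\mathcal{C}$ and in $\mathcal{C}'$ are invertible, then $F$ is a tensor equivalence.
   Context: A finite tensor category over $\Bbbk$ is a finite $\Bbbk$-linear abelian category (i.e. equivalent, as a $\Bbbk$-linear abelian category, to the category of finite-dimensional modules over a finite-dimensional $\Bbbk$-algebra) which is rigid monoidal with $\Bbbk$-bilinear tensor product and with $\operatorname{End}(\mathbf{1})=\Bbbk$ for the unit object $\mathbf{1}$. An object $X$ is invertible if its evaluation $X^*\otimes X\to\mathbf{1}$ and coevaluation $\mathbf{1}\to X\otimes X^*$ are isomorphisms. Monoidal functors are strong: they come with coherent natural isomorphisms $F(X)\otimes F(Y)\cong F(X\otimes Y)$ and $F(\mathbf{1})\cong\mathbf{1}$. The stable category $\underline{\mathcal{C}}$ of a $\Bbbk$-linear abelian category $\mathcal{C}$ has the same objects as $\mathcal{C}$, and morphism spaces $\underline{\operatorname{Hom}}_{\mathcal{C}}(X,Y)=\operatorname{Hom}_{\mathcal{C}}(X,Y)/\mathcal{P}(X,Y)$, where $\mathcal{P}(X,Y)$ is the subspace of morphisms factoring through a projective object. The class of $f$ is written $\underline{f}$. If a $\Bbbk$-linear functor $F:\mathcal{C}\to\mathcal{C}'$ maps projective objects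 to projective objects, it induces $\underline{F}:\underline{\mathcal{C}}\to\underline{\mathcal{C}'}$, $X\mapsto F(X)$, $\underline{f}\mapsto\underline{F(f)}$. ''$F$ induces a stable equivalence'' means that $F$ maps projectives to projectives and $\underline{F}$ is an equivalence of ($\Bbbk$-linear) categories. A tensor equivalence is a $\Bbbk$-linear monoidal functor that is an equivalence of categories. *)

(* Defs.v *)
From HB Require Import structures.
From mathcomp Require Import all_boot all_order all_algebra all_field.
From mathcomp Require Import boolp.

Set Implicit Arguments.
Unset Strict Implicit.
Unset Printing Implicit Defensive.

Import GRing.Theory.
Local Open Scope ring_scope.
Local Open Scope quotient_scope.

Declare Scope cat_scope.
Delimit Scope cat_scope with cat.
Local Open Scope cat_scope.

Reserved Notation "g ∘ f" (at level 40, left associativity).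
Reserved Notation "X ⊗ Y" (at level 39, left associativity).
Reserved Notation "f ⊠ g" (at level 39, left associativity).

Record linCat (k : fieldType) := LinCat {
  ob :> Type;
  hom : ob -> ob -> lmodType k;
  idc : forall X, hom X X;
  comp : forall X Y Z, hom Y Z -> hom X Y -> hom X Z;
  compIl : forall X Y (f : hom X Y), comp (idc Y) f = f;
  compIr : forall X Y (f : hom X Y), comp f (idc X) = f;
  compA : forall X Y Z T (h : hom Z T) (g : hom Y Z) (f : hom X Y),
    comp h (comp g f) = comp (comp h g) f;
  comp_linl : forall X Y Z (a : k) (g g' : hom Y Z) (f : hom X Y),
    comp (a *: g + g') f = a *: comp g f + comp g' f;
  comp_linr : forall X Y Z (a : k) (g : hom Y Z) (f f' : hom X Y),
    comp g (a *: f + f') = a *: comp g f + comp g f'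
}.

Arguments hom {k l} X Y.
Arguments idc {k l} X.
Arguments comp {k l X Y Z} g f.
Notation "g ∘ f" := (comp g f) : cat_scope.

(* Not assumed linear: linearity is the separate predicate [linearFunctor]. *)
Record functor (k : fieldType) (C D : linCat k) := Functor {
  fob :> C -> D;
  fmap : forall X Y : C, hom X Y -> hom (fob X) (fob Y);
  fmapI : forall X : C, fmap (idc X) = idc (fob X);
  fmapM : forall (X Y Z : C) (g : hom Y Z) (f : hom X Y),
    fmap (g ∘ f) = fmap g ∘ fmap f
}.

Arguments fmap {k C D} F {X Y} f : rename.

Definition linearFunctor (k : fieldType) (C D : linCat k) (F : functor C D) :=
  forall (X Y : C) (a : k) (f g : hom X Y),
    fmap F (a *: f + g) = a *: fmap F f + fmap F g.

Definition idFunctor (k : fieldType) (C : linCat k) : functor C C :=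
  @Functor k C C id (fun _ _ f => f) (fun _ => erefl) (fun _ _ _ _ _ => erefl).

Section CompFunctor.
Context {k : fieldType} {C D E : linCat k}.
Variables (G : functor D E) (F : functor C D).

Fact compFunctor_id (X : C) : fmap G (fmap F (idc X)) = idc (G (F X)).
Proof. by rewrite !fmapI. Qed.

Fact compFunctor_comp (X Y Z : C) (g : hom Y Z) (f : hom X Y) :
  fmap G (fmap F (g ∘ f)) = fmap G (fmap F g) ∘ fmap G (fmap F f).
Proof. by rewrite !fmapM. Qed.

Definition compFunctor : functor C E :=
  Functor (fob := fun X => G (F X)) compFunctor_id compFunctor_comp.

End CompFunctor.

Section Morphisms.
Context {k : fieldType} {C : linCat k}.
Implicit Types X Y Z : C.

Definition iso X Y (f : hom X Y) :=
  exists g : hom Y X, g ∘ f = idc X /\ f ∘ g = idc Y.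

Definition mono X Y (f : hom X Y) :=
  forall Z (g h : hom Z X), f ∘ g = f ∘ h -> g = h.

Definition epi X Y (f : hom X Y) :=
  forall Z (g h : hom Y Z), g ∘ f = h ∘ f -> g = h.

Definition isKernel X Y Z (f : hom Y Z) (i : hom X Y) :=
  f ∘ i = 0 /\
  forall T (g : hom T Y), f ∘ g = 0 -> exists! h : hom T X, i ∘ h = g.

Definition isCokernel X Y Z (f : hom X Y) (p : hom Y Z) :=
  p ∘ f = 0 /\
  forall T (g : hom Y T), g ∘ f = 0 -> exists! h : hom Z T, h ∘ p = g.

Definition shortExact X Y Z (f : hom X Y) (g : hom Y Z) :=
  isKernel g f /\ isCokernel f g.

(* The case n = 0 says that X is a zero object. *)
Definition isDirectSum n (S : 'I_n -> C) X :=
  exists (i : forall j, hom (S j) X) (p : forall j, hom X (S j)),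
  [/\ forall j, p j ∘ i j = idc (S j),
      forall j l, j != l -> p l ∘ i j = 0
    & \sum_j i j ∘ p j = idc X].

Definition isZero X := idc X = 0.

Definition simple X :=
  ~ isZero X /\ forall Y (m : hom Y X), mono m -> isZero Y \/ iso m.

Definition projective (P : C) :=
  forall X Y (e : hom X Y) (f : hom P Y), epi e -> exists g, e ∘ g = f.

End Morphisms.

Definition natIso (k : fieldType) (C D : linCat k) (F G : functor C D) :=
  exists t : forall X : C, hom (F X) (G X),
    (forall X, iso (t X)) /\
    (forall (X Y : C) (f : hom X Y), t Y ∘ fmap F f = fmap G f ∘ t X).

Definition equivalence (k : fieldType) (C D : linCat k) (F : functor C D) :=
  exists G : functor D C,
    natIso (compFunctor G F) (idFunctor C) /\
    natIso (compFunctor F G) (idFunctor D).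

Definition exact (k : fieldType) (C D : linCat k) (F : functor C D) :=
  forall (X Y Z : C) (f : hom X Y) (g : hom Y Z),
    shortExact f g -> shortExact (fmap F f) (fmap F g).

Definition semisimple (k : fieldType) (C : linCat k) :=
  forall X : C, exists n (S : 'I_n -> C),
    (forall j, simple (S j)) /\ isDirectSum S X.

Definition abelian (k : fieldType) (C : linCat k) :=
  [/\ forall n (S : 'I_n -> C), exists X, isDirectSum S X,
      forall (X Y : C) (f : hom X Y), exists K (i : hom K X), isKernel f i,
      forall (X Y : C) (f : hom X Y), exists Q (p : hom Y Q), isCokernel f p,
      forall (X Y : C) (m : hom X Y), mono m ->
        exists Z (f : hom Y Z), isKernel f m
    & forall (X Y : C) (e : hom X Y), epi e ->
        exists Z (f : hom Z X), isCokernel f e].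

Record abCat (k : fieldType) := AbCat {
  abCat_cat :> linCat k;
  abCatP : abelian abCat_cat
}.

Section LinCatTheory.
Context {k : fieldType} {C : linCat k}.
Implicit Types X Y Z : C.

Lemma compDl X Y Z (g g' : hom Y Z) (f : hom X Y) :
  (g + g') ∘ f = g ∘ f + g' ∘ f.
Proof. by rewrite -[g in LHS]scale1r comp_linl scale1r. Qed.

Lemma compDr X Y Z (g : hom Y Z) (f f' : hom X Y) :
  g ∘ (f + f') = g ∘ f + g ∘ f'.
Proof. by rewrite -[f in LHS]scale1r comp_linr scale1r. Qed.

Lemma comp0l X Y Z (f : hom X Y) : (0 : hom Y Z) ∘ f = 0.
Proof. by apply: (addIr (0 ∘ f)); rewrite -compDl !add0r. Qed.

Lemma comp0r X Y Z (g : hom Y Z) : g ∘ (0 : hom X Y) = 0.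
Proof. by apply: (addIr (g ∘ 0)); rewrite -compDr !add0r. Qed.

Lemma compZl X Y Z a (g : hom Y Z) (f : hom X Y) :
  (a *: g) ∘ f = a *: (g ∘ f).
Proof. by rewrite -[a *: g]addr0 comp_linl comp0l addr0. Qed.

Lemma compZr X Y Z a (g : hom Y Z) (f : hom X Y) :
  g ∘ (a *: f) = a *: (g ∘ f).
Proof. by rewrite -[a *: f]addr0 comp_linr comp0r addr0. Qed.

Lemma compNl X Y Z (g : hom Y Z) (f : hom X Y) : (- g) ∘ f = - (g ∘ f).
Proof. by rewrite -scaleN1r compZl scaleN1r. Qed.

Lemma compNr X Y Z (g : hom Y Z) (f : hom X Y) : g ∘ (- f) = - (g ∘ f).
Proof. by rewrite -scaleN1r compZr scaleN1r. Qed.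

Lemma comp_sumr (I : Type) (r : seq I) (P : pred I) X Y Z (g : hom Y Z)
    (F : I -> hom X Y) :
  g ∘ (\sum_(i <- r | P i) F i) = \sum_(i <- r | P i) (g ∘ F i).
Proof. by apply: (big_morph (comp g) (compDr g)); rewrite comp0r. Qed.

Lemma comp_suml (I : Type) (r : seq I) (P : pred I) X Y Z
    (F : I -> hom Y Z) (f : hom X Y) :
  (\sum_(i <- r | P i) F i) ∘ f = \sum_(i <- r | P i) (F i ∘ f).
Proof.
by apply: (big_morph (fun g => g ∘ f) (fun g g' => compDl g g' f)); rewrite comp0l.
Qed.

Lemma projective_sum n (S : 'I_n -> C) X :
  isDirectSum S X -> (forall j, projective (S j)) -> projective X.
Proof.
move=> [i [p [_ _ sumX]]] projS Y Z e f epie.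
have lift_i j : exists g : hom (S j) Y, e ∘ g = f ∘ i j by apply: projS.
pose g j := projT1 (cid (lift_i j)).
have eg j : e ∘ g j = f ∘ i j := projT2 (cid (lift_i j)).
exists (\sum_j (g j ∘ p j)); rewrite comp_sumr -[f in RHS]compIr -sumX comp_sumr.
by apply: eq_bigr => j _; rewrite !compA eg.
Qed.

End LinCatTheory.

Section LmodQuotient.
Context {k : fieldType} {V : lmodType k}.
Variables (S : zmodClosed V) (scaleS : GRing.scaler_closed S).

Definition lmodQuot of GRing.scaler_closed S := Quotient.quot S.
Local Notation VS := (lmodQuot scaleS).
HB.instance Definition _ := GRing.Zmodule.on VS.

Definition lmodPi (x : V) : VS := \pi_(Quotient.quot S) x.
Definition lmodRepr (x : VS) : V := repr (x : Quotient.quot S).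

Lemma lmodReprK : cancel lmodRepr lmodPi.
Proof. by move=> x; apply: reprK. Qed.

Lemma lmodPi_eq x y : lmodPi x = lmodPi y <-> x - y \in S.
Proof.
rewrite Quotient.idealrBE; split=> [/eqP //|/eqP]; exact.
Qed.

Lemma lmodPiD x y : lmodPi (x + y) = lmodPi x + lmodPi y.
Proof. by rewrite /lmodPi !piE. Qed.

Lemma lmodRepr_pi x : lmodRepr (lmodPi x) - x \in S.
Proof. by apply/lmodPi_eq; rewrite lmodReprK. Qed.

Definition lmodQuot_scale (a : k) (x : VS) := lmodPi (a *: lmodRepr x).

Lemma lmodPiZ_def a x : lmodPi (a *: x) = lmodQuot_scale a (lmodPi x).
Proof.
by apply/lmodPi_eq; rewrite -scalerBr scaleS // -opprB rpredN lmodRepr_pi.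
Qed.

Fact lmodQuot_scaleA a b x :
  lmodQuot_scale a (lmodQuot_scale b x) = lmodQuot_scale (a * b) x.
Proof. by rewrite -[x]lmodReprK -!lmodPiZ_def scalerA. Qed.

Fact lmodQuot_scale1 : left_id 1 lmodQuot_scale.
Proof. by move=> x; rewrite -[x]lmodReprK -!lmodPiZ_def scale1r. Qed.

Fact lmodQuot_scaleDr : right_distributive lmodQuot_scale +%R.
Proof.
move=> a x y; rewrite -[x]lmodReprK -[y]lmodReprK.
by rewrite -lmodPiD -!lmodPiZ_def scalerDr lmodPiD.
Qed.

Fact lmodQuot_scaleDl x : {morph lmodQuot_scale^~ x : a b / a + b}.
Proof. by move=> a b; rewrite -[x]lmodReprK -!lmodPiZ_def scalerDl lmodPiD. Qed.

HB.instance Definition _ := GRing.Zmodule_isLmodule.Build k VS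
  lmodQuot_scaleA lmodQuot_scale1 lmodQuot_scaleDr lmodQuot_scaleDl.

Lemma lmodPiZ a x : lmodPi (a *: x) = a *: lmodPi x.
Proof. exact: lmodPiZ_def. Qed.

End LmodQuotient.

Section Stable.
Context {k : fieldType} {C : abCat k}.
Implicit Types X Y Z : C.

Definition factorsProj X Y (f : hom X Y) :=
  exists (P : C) (v : hom P Y) (u : hom X P), projective P /\ f = v ∘ u.

Definition factorsProj_pred X Y : {pred hom X Y} := fun f => `[< factorsProj f >].

Lemma factorsProjP X Y (f : hom X Y) :
  reflect (factorsProj f) (f \in @factorsProj_pred X Y).
Proof. exact: asboolP. Qed.

Lemma factorsProj_compl X Y Z (g : hom Y Z) (f : hom X Y) :
  factorsProj f -> factorsProj (g ∘ f).
Proof. by move=> [P [v [u [pP ->]]]]; exists P, (g ∘ v), u; rewrite compA. Qed.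

Lemma factorsProj_compr X Y Z (g : hom Y Z) (f : hom X Y) :
  factorsProj g -> factorsProj (g ∘ f).
Proof. by move=> [P [v [u [pP ->]]]]; exists P, v, (u ∘ f); rewrite compA. Qed.

Fact factorsProj_submod X Y : submod_closed (@factorsProj_pred X Y).
Proof.
have [sums _ _ _ _] := abCatP C; split.
  apply/factorsProjP; have [P sP] := sums 0 (fun _ => X).
  by exists P, 0, 0; split; [apply: projective_sum sP _ => -[] | rewrite comp0r].
move=> a f g /factorsProjP[P [v [u [pP ->]]]] /factorsProjP[Q [w [t [pQ ->]]]].
apply/factorsProjP; pose S (j : 'I_2) := if j == ord0 then P else Q.
have [R sR] := sums 2 S; case: (sR) => i [p [pi1 pi0 _]].
have i0 : ord0 != lift ord0 (ord0 : 'I_1) :> 'I_2 by [].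
pose i0R : hom P R := i ord0; pose i1R : hom Q R := i (lift ord0 ord0).
pose p0R : hom R P := p ord0; pose p1R : hom R Q := p (lift ord0 ord0).
have e00 : p0R ∘ i0R = idc P := pi1 ord0.
have e11 : p1R ∘ i1R = idc Q := pi1 (lift ord0 ord0).
have e10 : p1R ∘ i0R = 0 := pi0 _ _ i0.
have e01 : p0R ∘ i1R = 0 by apply: (pi0 (lift ord0 ord0) ord0).
exists R, (a *: (v ∘ p0R) + w ∘ p1R), (i0R ∘ u + i1R ∘ t); split.
  by apply: projective_sum sR _ => j; rewrite /S; case: ifP.
rewrite compDr !comp_linl !compA -![_ ∘ _ ∘ i0R]compA -![_ ∘ _ ∘ i1R]compA.
by rewrite e00 e11 e10 e01 !comp0r !compIr !comp0l scaler0 addr0 add0r.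
Qed.

Fact factorsProj_scale X Y : GRing.scaler_closed (@factorsProj_pred X Y).
Proof.
by move=> a f Sf; have [S0 Slin] := factorsProj_submod X Y; rewrite -[_ *: _]addr0 Slin.
Qed.

HB.instance Definition _ X Y :=
  GRing.isZmodClosed.Build (hom X Y) (@factorsProj_pred X Y)
    (GRing.submod_closedB (factorsProj_submod X Y)).

Definition stableHom X Y : lmodType k := lmodQuot (@factorsProj_scale X Y).

Definition stableClass X Y (f : hom X Y) : stableHom X Y :=
  lmodPi (@factorsProj_scale X Y) f.

Lemma stableClass_eq X Y (f g : hom X Y) :
  stableClass f = stableClass g <-> factorsProj (f - g).
Proof. by rewrite lmodPi_eq; split=> /factorsProjP. Qed.

Definition stableComp X Y Z (g : stableHom Y Z) (f : stableHom X Y) :=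
  stableClass (lmodRepr g ∘ lmodRepr f).

Lemma stableCompE X Y Z (g : hom Y Z) (f : hom X Y) :
  stableComp (stableClass g) (stableClass f) = stableClass (g ∘ f).
Proof.
set f' := lmodRepr (stableClass f); set g' := lmodRepr (stableClass g).
have Df : factorsProj (f' - f) by apply/factorsProjP/lmodRepr_pi.
have Dg : factorsProj (g' - g) by apply/factorsProjP/lmodRepr_pi.
apply/stableClass_eq; rewrite -/f' -/g'.
have -> : g' ∘ f' - g ∘ f = g' ∘ (f' - f) + (g' - g) ∘ f.
  by rewrite compDr compDl compNr compNl addrA addrNK.
by apply/factorsProjP/rpredD; apply/factorsProjP;
  [apply: factorsProj_compl | apply: factorsProj_compr].
Qed.

Lemma stableClass_lin X Y a (f g : hom X Y) :
  stableClass (a *: f + g) = a *: stableClass f + stableClass g.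
Proof. by rewrite /stableClass lmodPiD lmodPiZ. Qed.

Lemma stableClassW X Y (P : stableHom X Y -> Prop) :
  (forall f, P (stableClass f)) -> forall f, P f.
Proof. by move=> Pcl f; rewrite -[f]lmodReprK; apply: Pcl. Qed.

Fact stable_compIl X Y (f : stableHom X Y) :
  stableComp (stableClass (idc Y)) f = f.
Proof. by elim/stableClassW: f => f; rewrite stableCompE compIl. Qed.

Fact stable_compIr X Y (f : stableHom X Y) :
  stableComp f (stableClass (idc X)) = f.
Proof. by elim/stableClassW: f => f; rewrite stableCompE compIr. Qed.

Fact stable_compA X Y Z T
    (h : stableHom Z T) (g : stableHom Y Z) (f : stableHom X Y) :
  stableComp h (stableComp g f) = stableComp (stableComp h g) f.
Proof.
elim/stableClassW: h => h; elim/stableClassW: g => g; elim/stableClassW: f => f.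
by rewrite !stableCompE compA.
Qed.

Fact stable_comp_linl X Y Z a (g g' : stableHom Y Z) (f : stableHom X Y) :
  stableComp (a *: g + g') f = a *: stableComp g f + stableComp g' f.
Proof.
elim/stableClassW: g => g; elim/stableClassW: g' => g'.
elim/stableClassW: f => f.
by rewrite -stableClass_lin !stableCompE -stableClass_lin comp_linl.
Qed.

Fact stable_comp_linr X Y Z a (g : stableHom Y Z) (f f' : stableHom X Y) :
  stableComp g (a *: f + f') = a *: stableComp g f + stableComp g f'.
Proof.
elim/stableClassW: g => g; elim/stableClassW: f => f.
elim/stableClassW: f' => f'.
by rewrite -stableClass_lin !stableCompE -stableClass_lin comp_linr.
Qed.

End Stable.

Definition stableCat (k : fieldType) (C : abCat k) : linCat k :=
  @LinCat k C (@stableHom k C) (fun X => stableClass (idc X)) (@stableComp k C)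
    (@stable_compIl k C) (@stable_compIr k C) (@stable_compA k C)
    (@stable_comp_linl k C) (@stable_comp_linr k C).

Section StableFunctor.
Context {k : fieldType} {C D : abCat k}.
Variable F : functor C D.

Definition preservesProj := forall P : C, projective P -> projective (F P).

Hypothesis linF : linearFunctor F.
Hypothesis projF : preservesProj.

Definition stableMap (X Y : C) (f : stableHom X Y) : stableHom (F X) (F Y) :=
  stableClass (fmap F (lmodRepr f)).

Lemma stableMapE (X Y : C) (f : hom X Y) :
  stableMap (stableClass f) = stableClass (fmap F f).
Proof.
set f' := lmodRepr (stableClass f); apply/stableClass_eq; rewrite -/f'.
have /factorsProjP[P [v [u [pP Ef]]]] : f' - f \in @factorsProj_pred k C X Y.
  exact: lmodRepr_pi.
exists (F P), (fmap F v), (fmap F u); split; first exact: projF.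
rewrite -fmapM -Ef; have := linF (-1) f f'.
by rewrite !scaleN1r addrC => ->; rewrite addrC.
Qed.

Fact stableFunctor_id (X : stableCat C) :
  stableMap (idc X) = idc (F X : stableCat D).
Proof. by rewrite stableMapE fmapI. Qed.

Fact stableFunctor_comp (X Y Z : stableCat C) (g : hom Y Z) (f : hom X Y) :
  stableMap (g ∘ f) =
  (stableMap g : @hom k (stableCat D) (F Y) (F Z)) ∘
  (stableMap f : @hom k (stableCat D) (F X) (F Y)).
Proof.
rewrite -[g](lmodReprK (V := hom (Y : C) Z)) -[f](lmodReprK (V := hom (X : C) Y)).
by rewrite /= stableCompE !stableMapE fmapM stableCompE.
Qed.

Definition stableFunctor : functor (stableCat C) (stableCat D) :=
  @Functor k (stableCat C) (stableCat D) F stableMap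
    stableFunctor_id stableFunctor_comp.

Fact stableFunctor_lin : linearFunctor stableFunctor.
Proof.
move=> X Y a f g; rewrite -[f](lmodReprK (V := hom (X : C) Y)).
rewrite -[g](lmodReprK (V := hom (X : C) Y)) -[X in fmap _ X]stableClass_lin.
by rewrite /= !stableMapE linF stableClass_lin.
Qed.

End StableFunctor.

Definition inducesStableEquivalence (k : fieldType) (C D : abCat k)
    (F : functor C D) (linF : linearFunctor F) :=
  exists projF : preservesProj F, equivalence (stableFunctor linF projF).

Section Modules.
Context {k : fieldType}.
Variable A : falgType k.

Record fdMod := FdMod {
  fdm_space :> vectType k;
  fdm_act : {linear A -> 'End(fdm_space)};
  fdm_act1 : fdm_act 1 = \1%VF;
  fdm_actM : forall a b, fdm_act (a * b) = (fdm_act a \o fdm_act b)%VF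
}.

Definition fdModHom_pred (M N : fdMod) : {pred 'Hom(M, N)} :=
  fun f => `[< forall a x, f (fdm_act M a x) = fdm_act N a (f x) >].

Fact fdModHom_submod (M N : fdMod) : submod_closed (@fdModHom_pred M N).
Proof.
split; first by apply/asboolP => a x; rewrite !lfunE /= linear0.
move=> c f g /asboolP Hf /asboolP Hg; apply/asboolP => a x.
by rewrite !lfunE /= !lfunE /= Hf Hg linearP.
Qed.

HB.instance Definition _ (M N : fdMod) :=
  GRing.isSubmodClosed.Build k 'Hom(M, N) (@fdModHom_pred M N)
    (fdModHom_submod M N).

Record fdModHom (M N : fdMod) := FdModHom {
  fdmh_val :> 'Hom(M, N);
  fdmh_valP : fdmh_val \in @fdModHom_pred M N
}.

HB.instance Definition _ (M N : fdMod) := [isSub for @fdmh_val M N].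
HB.instance Definition _ (M N : fdMod) := [Choice of fdModHom M N by <:].
HB.instance Definition _ (M N : fdMod) :=
  [SubChoice_isSubLmodule of fdModHom M N by <:].

Fact fdMod_idP (M : fdMod) : \1%VF \in @fdModHom_pred M M.
Proof. by apply/asboolP => a x; rewrite !lfunE. Qed.

Fact fdMod_compP (M N P : fdMod) (g : fdModHom N P) (f : fdModHom M N) :
  (fdmh_val g \o fdmh_val f)%VF \in @fdModHom_pred M P.
Proof.
have /asboolP Hg := fdmh_valP g; have /asboolP Hf := fdmh_valP f.
by apply/asboolP => a x; rewrite !lfunE /= Hf Hg.
Qed.

Definition fdMod_id M : fdModHom M M := FdModHom (fdMod_idP M).
Definition fdMod_comp M N P (g : fdModHom N P) (f : fdModHom M N) :
  fdModHom M P := FdModHom (fdMod_compP g f).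

Fact fdMod_compIl M N (f : fdModHom M N) : fdMod_comp (fdMod_id N) f = f.
Proof. by apply: val_inj; rewrite /= comp_lfun1l. Qed.

Fact fdMod_compIr M N (f : fdModHom M N) : fdMod_comp f (fdMod_id M) = f.
Proof. by apply: val_inj; rewrite /= comp_lfun1r. Qed.

Fact fdMod_compA M N P Q
    (h : fdModHom P Q) (g : fdModHom N P) (f : fdModHom M N) :
  fdMod_comp h (fdMod_comp g f) = fdMod_comp (fdMod_comp h g) f.
Proof. by apply: val_inj; rewrite /= comp_lfunA. Qed.

Fact fdMod_comp_linl M N P (a : k) (g g' : fdModHom N P) (f : fdModHom M N) :
  fdMod_comp (a *: g + g') f = a *: fdMod_comp g f + fdMod_comp g' f.
Proof. by apply: val_inj; rewrite /= comp_lfunDl comp_lfunZl. Qed.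

Fact fdMod_comp_linr M N P (a : k) (g : fdModHom N P) (f f' : fdModHom M N) :
  fdMod_comp g (a *: f + f') = a *: fdMod_comp g f + fdMod_comp g f'.
Proof. by apply: val_inj; rewrite /= comp_lfunDr comp_lfunZr. Qed.

Definition fdModCat : linCat k :=
  @LinCat k fdMod (fun M N => fdModHom M N) fdMod_id fdMod_comp
    fdMod_compIl fdMod_compIr fdMod_compA fdMod_comp_linl fdMod_comp_linr.

End Modules.

(* An [falgType] is a nonzero algebra, so this leaves out the zero category;
   that category does not satisfy End(1) = k. *)
Definition finiteCat (k : fieldType) (C : linCat k) :=
  exists (A : falgType k) (E : functor C (fdModCat A)),
    linearFunctor E /\ equivalence E.

Record monoidal (k : fieldType) (C : linCat k) := Monoidal {
  unitm : C;
  tens : C -> C -> C;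
  tensh : forall X X' Y Y' : C,
    hom X X' -> hom Y Y' -> hom (tens X Y) (tens X' Y');
  tenshI : forall X Y, tensh (idc X) (idc Y) = idc (tens X Y);
  tenshM : forall (X X' X'' Y Y' Y'' : C)
      (f' : hom X' X'') (f : hom X X') (g' : hom Y' Y'') (g : hom Y Y'),
    tensh (f' ∘ f) (g' ∘ g) = tensh f' g' ∘ tensh f g;
  assoc : forall X Y Z, hom (tens (tens X Y) Z) (tens X (tens Y Z));
  assocV : forall X Y Z, hom (tens X (tens Y Z)) (tens (tens X Y) Z);
  assocK : forall X Y Z, assocV X Y Z ∘ assoc X Y Z = idc _;
  assocVK : forall X Y Z, assoc X Y Z ∘ assocV X Y Z = idc _;
  assoc_nat : forall (X X' Y Y' Z Z' : C)
      (f : hom X X') (g : hom Y Y') (h : hom Z Z'),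
    assoc X' Y' Z' ∘ tensh (tensh f g) h = tensh f (tensh g h) ∘ assoc X Y Z;
  lunit : forall X, hom (tens unitm X) X;
  lunit_iso : forall X, iso (lunit X);
  lunit_nat : forall (X X' : C) (f : hom X X'),
    lunit X' ∘ tensh (idc unitm) f = f ∘ lunit X;
  runit : forall X, hom (tens X unitm) X;
  runit_iso : forall X, iso (runit X);
  runit_nat : forall (X X' : C) (f : hom X X'),
    runit X' ∘ tensh f (idc unitm) = f ∘ runit X;
  triangle : forall X Y,
    tensh (idc X) (lunit Y) ∘ assoc X unitm Y = tensh (runit X) (idc Y);
  pentagon : forall W X Y Z,
    tensh (idc W) (assoc X Y Z) ∘ assoc W (tens X Y) Z
      ∘ tensh (assoc W X Y) (idc Z)
    = assoc W X (tens Y Z) ∘ assoc (tens W X) Y Z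
}.

Arguments unitm {k C} m.
Arguments tens {k C m} X Y.
Arguments tensh {k C m X X' Y Y'} f g.
Arguments assoc {k C m} X Y Z.
Arguments assocV {k C m} X Y Z.
Arguments lunit {k C m} X.
Arguments runit {k C m} X.

Notation "X ⊗ Y" := (tens X Y) : cat_scope.
Notation "f ⊠ g" := (tensh f g) : cat_scope.

Section MonoidalNotions.
Context {k : fieldType} {C : linCat k}.
Variable M : monoidal C.
Local Notation I := (unitm M).
Local Notation "X ⊗ Y" := (tens (m := M) X Y).
Local Notation "f ⊠ g" := (tensh (m := M) f g).

Definition bilinearTens :=
  (forall (X X' Y Y' : C) (a : k) (f f' : hom X X') (g : hom Y Y'),
     (a *: f + f') ⊠ g = a *: (f ⊠ g) + f' ⊠ g) /\
  (forall (X X' Y Y' : C) (a : k) (f : hom X X') (g g' : hom Y Y'),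
     f ⊠ (a *: g + g') = a *: (f ⊠ g) + f ⊠ g').

Definition leftDual (X Xd : C) (ev : hom (Xd ⊗ X) I) (coev : hom I (X ⊗ Xd)) :=
  runit X ∘ (idc X ⊠ ev) ∘ assoc X Xd X ∘ (coev ⊠ idc X) = lunit X /\
  lunit Xd ∘ (ev ⊠ idc Xd) ∘ assocV Xd X Xd ∘ (idc Xd ⊠ coev) = runit Xd.

(* Y is a right dual of X when X is a left dual of Y. *)
Definition rigid :=
  forall X : C,
    (exists Xd ev coev, @leftDual X Xd ev coev) /\
    (exists Y ev coev, @leftDual Y X ev coev).

(* Left duals are unique up to an isomorphism compatible with ev and coev, so
   this does not depend on the choice of the dual. *)
Definition invertible (X : C) :=
  exists Xd ev coev, [/\ @leftDual X Xd ev coev, iso ev & iso coev].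

End MonoidalNotions.

Record monFunctor (k : fieldType) (C D : linCat k)
    (M : monoidal C) (N : monoidal D) := MonFunctor {
  mf_functor :> functor C D;
  mf_tens : forall X Y : C,
    hom (tens (m := N) (mf_functor X) (mf_functor Y))
        (mf_functor (tens (m := M) X Y));
  mf_tens_iso : forall X Y, iso (mf_tens X Y);
  mf_tens_nat : forall (X X' Y Y' : C) (f : hom X X') (g : hom Y Y'),
    mf_tens X' Y' ∘ (fmap mf_functor f ⊠ fmap mf_functor g)
    = fmap mf_functor (f ⊠ g) ∘ mf_tens X Y;
  mf_unit : hom (unitm N) (mf_functor (unitm M));
  mf_unit_iso : iso mf_unit;
  mf_assoc : forall X Y Z : C,
    fmap mf_functor (assoc X Y Z) ∘ mf_tens (X ⊗ Y) Z
      ∘ (mf_tens X Y ⊠ idc (mf_functor Z))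
    = mf_tens X (Y ⊗ Z) ∘ (idc (mf_functor X) ⊠ mf_tens Y Z)
      ∘ assoc (mf_functor X) (mf_functor Y) (mf_functor Z);
  mf_lunit : forall X : C,
    fmap mf_functor (lunit X) ∘ mf_tens (unitm M) X
      ∘ (mf_unit ⊠ idc (mf_functor X)) = lunit (mf_functor X);
  mf_runit : forall X : C,
    fmap mf_functor (runit X) ∘ mf_tens X (unitm M)
      ∘ (idc (mf_functor X) ⊠ mf_unit) = runit (mf_functor X)
}.

Record finTensCat (k : fieldType) := FinTensCat {
  ftc_cat :> abCat k;
  ftc_monoidal : monoidal ftc_cat;
  ftc_finite : finiteCat ftc_cat;
  ftc_bilinear : bilinearTens ftc_monoidal;
  ftc_rigid : rigid ftc_monoidal;
  ftc_end1 : bijective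
    (fun a : k => a *: idc (unitm ftc_monoidal)
                  : hom (unitm ftc_monoidal) (unitm ftc_monoidal))
}.

Arguments ftc_monoidal {k} f.

Definition tensorEquivalence (k : fieldType) (C D : finTensCat k)
    (F : monFunctor (ftc_monoidal C) (ftc_monoidal D)) :=
  linearFunctor F /\ equivalence F.

(* Main.v *)
From HB Require Import structures.
From mathcomp Require Import all_boot all_order all_algebra all_field.
From mathcomp Require Import boolp.
Require Import Defs.

(** Why a stable equivalence [F] is an equivalence when all simple objects are
    invertible.

    The unit is simple, since tensoring by an invertible simple object [S] embeds
    its subobjects into those of [S] ([unit_simple]); hence every invertible
    object is simple ([tensorInvertible_simple]). A monoidal functor preserves
    invertibility, so [F] sends simple objects to simple objects, and being exact
    it is faithful ([exact_faithful]). In the target no invertible object is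
    projective: otherwise the unit, and then every object, would be projective
    and the category semisimple ([invertible_nonprojective]). By Schur's lemma a
    map between nonprojective simple objects that factors through a projective
    one vanishes, so on simple objects stable maps are the same as maps, and [F]
    is full between simple objects ([stable_full_simple]).

    Fullness spreads to all objects by dévissage. The difficult step
    ([fullAt_extension]) is the surjective half of the five lemma, where the
    injectivity of [F] on Ext^1 is read off the stable category: Ext^1(X, Y) is
    the space of maps from a syzygy of [X] to [Y] modulo those extending to the
    projective cover, and these are the maps factoring through a projective
    because projective objects are injective. That last fact
    ([projective_injective]) comes from rigidity: for [Q] projective with right
    dual [Y], the object Q ⊗ Y is both projective and injective and evaluation
    maps it onto the unit, so each projective [P] is a direct summand of the
    injective object P ⊗ (Q ⊗ Y).

    For essential surjectivity, a simple object [T] of the target is stably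
    isomorphic to some [F X]; a nonprojective [X] receives a stably nonzero map
    from some simple [S] ([simple_not_stably_zero]), which gives a nonzero map,
    hence an isomorphism, from [F S] to [T] ([simple_image]). By induction on
    length every object of the target is then a quotient of an object in the
    image, so it is the cokernel of a map between such objects, and [F] is full
    and exact ([essSurj_of_simple]). *)

Set Implicit Arguments.
Unset Strict Implicit.
Unset Printing Implicit Defensive.

Import GRing.Theory.
Local Open Scope ring_scope.
Local Open Scope cat_scope.

(** * Linear and abelian categories *)

Section LinearCategory.
Context {k : fieldType} {C : linCat k}.
Implicit Types X Y Z : C.

Lemma compBl X Y Z (g g' : hom Y Z) (f : hom X Y) :
  (g - g') ∘ f = g ∘ f - g' ∘ f.
Proof. by rewrite compDl compNl. Qed.

Lemma compBr X Y Z (g : hom Y Z) (f f' : hom X Y) :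
  g ∘ (f - f') = g ∘ f - g ∘ f'.
Proof. by rewrite compDr compNr. Qed.

Lemma iso_id X : iso (idc X).
Proof. by exists (idc X); rewrite compIl. Qed.

Lemma iso_comp X Y Z (g : hom Y Z) (f : hom X Y) : iso g -> iso f -> iso (g ∘ f).
Proof.
move=> [g' [g'g gg']] [f' [f'f ff']]; exists (f' ∘ g'); split.
  by rewrite -compA [g' ∘ _]compA g'g compIl.
by rewrite -compA [f ∘ _]compA ff' compIl.
Qed.

Lemma iso_square X X' Y Y' (f : hom X Y) (g : hom X' Y') (a : hom X X') (b : hom Y Y') :
  iso a -> iso b -> b ∘ f = g ∘ a -> iso f -> iso g.
Proof.
move=> [a' [a'a aa']] isob sq isof.
have -> : g = b ∘ f ∘ a' by rewrite sq -compA aa' compIr.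
by apply: iso_comp; [apply: iso_comp | exists a].
Qed.

Lemma iso_mono X Y (f : hom X Y) : iso f -> mono f.
Proof.
by move=> [g [gf _]] Z u v fuv; rewrite -[u]compIl -[v]compIl -gf -!compA fuv.
Qed.

Lemma iso_epi X Y (f : hom X Y) : iso f -> epi f.
Proof.
by move=> [g [_ fg]] Z u v fuv; rewrite -[u]compIr -[v]compIr -fg !compA fuv.
Qed.

Lemma mono0P X Y (f : hom X Y) :
  (forall Z (g : hom Z X), f ∘ g = 0 -> g = 0) -> mono f.
Proof.
by move=> f0 Z g h fgh; apply/subr0_eq/f0; rewrite compBr fgh subrr.
Qed.

Lemma epi0P X Y (f : hom X Y) :
  (forall Z (g : hom Y Z), g ∘ f = 0 -> g = 0) -> epi f.
Proof.
by move=> f0 Z g h fgh; apply/subr0_eq/f0; rewrite compBl fgh subrr.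
Qed.

Lemma mono0 X Y Z (f : hom X Y) (g : hom Z X) : mono f -> f ∘ g = 0 -> g = 0.
Proof. by move=> mf fg; apply: mf; rewrite fg comp0r. Qed.

Lemma epi0 X Y Z (f : hom X Y) (g : hom Y Z) : epi f -> g ∘ f = 0 -> g = 0.
Proof. by move=> ef gf; apply: ef; rewrite gf comp0l. Qed.

Lemma mono_comp X Y Z (g : hom Y Z) (f : hom X Y) : mono g -> mono f -> mono (g ∘ f).
Proof. by move=> mg mf T u v; rewrite -!compA => /mg /mf. Qed.

Lemma epi_comp X Y Z (g : hom Y Z) (f : hom X Y) : epi g -> epi f -> epi (g ∘ f).
Proof. by move=> eg ef T u v; rewrite !compA => /ef /eg. Qed.

Lemma zero_dom X Y (f : hom X Y) : isZero X -> f = 0.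
Proof. by move=> X0; rewrite -[f]compIr X0 comp0r. Qed.

Lemma zero_cod X Y (f : hom X Y) : isZero Y -> f = 0.
Proof. by move=> X0; rewrite -[f]compIl X0 comp0l. Qed.

Lemma zero_iso X Y (f : hom X Y) : iso f -> isZero X -> isZero Y.
Proof. by move=> [g [_ fg]] X0; rewrite /isZero -fg (zero_dom f X0) comp0l. Qed.

Lemma mono_zero X Y (f : hom X Y) : mono f -> isZero Y -> isZero X.
Proof. by move=> mf Y0; apply: (mono0 mf); apply: zero_cod. Qed.

Lemma kernel_mono X Y Z (f : hom Y Z) (i : hom X Y) : isKernel f i -> mono i.
Proof.
move=> [fi uni]; apply: mono0P => T g ig0; have [|h [_ hu]] := uni T 0.
  by rewrite comp0r.
by rewrite -(hu g ig0); apply: hu; rewrite comp0r.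
Qed.

Lemma cokernel_epi X Y Z (f : hom X Y) (p : hom Y Z) : isCokernel f p -> epi p.
Proof.
move=> [pf uni]; apply: epi0P => T g gp0; have [|h [_ hu]] := uni T 0.
  by rewrite comp0l.
by rewrite -(hu g gp0); apply: hu; rewrite comp0l.
Qed.

Lemma kernel_lift X Y Z T (f : hom Y Z) (i : hom X Y) (g : hom T Y) :
  isKernel f i -> f ∘ g = 0 -> exists h, i ∘ h = g.
Proof. by move=> [_ uni] /uni[h [ih _]]; exists h. Qed.

Lemma cokernel_desc X Y Z T (f : hom X Y) (p : hom Y Z) (g : hom Y T) :
  isCokernel f p -> g ∘ f = 0 -> exists h, h ∘ p = g.
Proof. by move=> [_ uni] /uni[h [ih _]]; exists h. Qed.

Lemma kernelI X Y Z (f : hom Y Z) (i : hom X Y) :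
    f ∘ i = 0 -> mono i ->
    (forall T (g : hom T Y), f ∘ g = 0 -> exists h, i ∘ h = g) -> isKernel f i.
Proof.
move=> fi mi lft; split=> // T g /lft[h ih]; exists h; split=> // h' ih'.
by apply: mi; rewrite ih ih'.
Qed.

Lemma cokernelI X Y Z (f : hom X Y) (p : hom Y Z) :
    p ∘ f = 0 -> epi p ->
    (forall T (g : hom Y T), g ∘ f = 0 -> exists h, h ∘ p = g) -> isCokernel f p.
Proof.
move=> fi mi lft; split=> // T g /lft[h ih]; exists h; split=> // h' ih'.
by apply: mi; rewrite ih ih'.
Qed.

Definition injective_ob I :=
  forall X Y (m : hom X Y) (f : hom X I), mono m -> exists g, g ∘ m = f.

Lemma projective_retract P X (s : hom X P) (r : hom P X) :
  r ∘ s = idc X -> projective P -> projective X.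
Proof.
move=> rs projP Y Z e f epie; have [g eg] := projP _ _ e (f ∘ r) epie.
by exists (g ∘ s); rewrite compA eg -compA rs compIr.
Qed.

Lemma injective_retract P X (s : hom X P) (r : hom P X) :
  r ∘ s = idc X -> injective_ob P -> injective_ob X.
Proof.
move=> rs injP Y Z m f monom; have [g gm] := injP _ _ m (s ∘ f) monom.
by exists (r ∘ g); rewrite -compA gm compA rs compIl.
Qed.

Lemma projective_split P X (e : hom P X) :
  epi e -> projective X -> exists s, e ∘ s = idc X.
Proof. by move=> ee pX; apply: pX. Qed.

Lemma projective_iso X Y (f : hom X Y) : iso f -> projective X -> projective Y.
Proof. by move=> [g [_ fg]]; apply: (projective_retract fg). Qed.

Lemma iso_projective_factor X Y P (v : hom P Y) (u : hom X P) :
  iso (v ∘ u) -> projective P -> projective X.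
Proof.
move=> [g [gf _]]; apply: (@projective_retract P X u (g ∘ v)).
by rewrite -compA.
Qed.

End LinearCategory.

Section Equivalences.
Context {k : fieldType} {C D : linCat k}.
Implicit Types F : functor C D.

Definition faithful F := forall (X Y : C) (f g : hom X Y), fmap F f = fmap F g -> f = g.
Definition full F := forall (X Y : C) (f : hom (F X) (F Y)), exists g, fmap F g = f.
Definition essSurj F := forall Y : D, exists X (f : hom (F X) Y), iso f.

Lemma fmap_iso F X Y (f : hom X Y) : iso f -> iso (fmap F f).
Proof.
by move=> [g [gf fg]]; exists (fmap F g); rewrite -!fmapM gf fg !fmapI.
Qed.

Lemma ff_iso F X Y (f : hom X Y) : faithful F -> full F -> iso (fmap F f) -> iso f.
Proof.
move=> faiF fulF [g [gf fg]]; have [h hE] := fulF _ _ g; exists h.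
by split; apply: faiF; rewrite fmapM fmapI hE.
Qed.

Lemma equiv_natIso_faithful (F : functor C D) (G : functor D C) :
  natIso (compFunctor G F) (idFunctor C) -> faithful F.
Proof.
move=> [t [tiso tnat]] X Y f g Ffg.
have epit : epi (t X : hom _ X) := iso_epi (tiso X).
by apply: epit; move: (tnat _ _ f) (tnat _ _ g) => /= <- <-; rewrite Ffg.
Qed.

Lemma equivalence_faithful F : equivalence F -> faithful F.
Proof. by move=> [G [GF FG]]; apply: equiv_natIso_faithful GF. Qed.

Lemma equivalence_essSurj F : equivalence F -> essSurj F.
Proof. by move=> [G [_ [t [tiso _]]]] Y; exists (G Y), (t Y); apply: (tiso Y). Qed.

End Equivalences.

(** Naturality of the isomorphism from [G ∘ F] to the identity forces the
    preimage of [f] to be [G f] conjugated by it; that this is a preimage can be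
    checked after applying [G], which is faithful. *)
Lemma equivalence_full (k : fieldType) (C D : linCat k) (F : functor C D) :
  equivalence F -> full F.
Proof.
move=> [G [GF FG]] X Y f; have faiG := equiv_natIso_faithful FG.
case: GF => t [tiso tnat]; case: (tiso X) => s [st ts].
exists (t Y ∘ fmap G f ∘ s); apply: faiG.
have := tnat _ _ (t Y ∘ fmap G f ∘ s).
rewrite /= -!compA st compIr; exact: (iso_mono (tiso Y)).
Qed.

(** The inverse picks preimages of objects and maps by choice. *)
Lemma ff_equivalence (k : fieldType) (C D : linCat k) (F : functor C D) :
  faithful F -> full F -> essSurj F -> equivalence F.
Proof.
move=> faiF fulF essF.
pose G0 Y := projT1 (cid (essF Y)).
have Gt Y : {t : hom (F (G0 Y)) Y & iso t} by apply: cid; apply: projT2 (cid (essF Y)).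
pose t Y := projT1 (Gt Y).
have tiso Y : iso (t Y) := projT2 (Gt Y).
pose s Y := projT1 (cid (tiso Y)).
have st Y : s Y ∘ t Y = idc _ := proj1 (projT2 (cid (tiso Y))).
have ts Y : t Y ∘ s Y = idc _ := proj2 (projT2 (cid (tiso Y))).
pose inv X Y (f : hom (F X) (F Y)) := projT1 (cid (fulF X Y f)).
have invE X Y f : fmap F (@inv X Y f) = f := projT2 (cid (fulF X Y f)).
pose G1 (X Y : D) (f : hom X Y) := inv _ _ (s Y ∘ f ∘ t X).
have G1I X : G1 X X (idc X) = idc (G0 X).
  by apply: faiF; rewrite invE fmapI compIr st.
have G1M (X Y Z : D) (g : hom Y Z) (f : hom X Y) :
    G1 X Z (g ∘ f) = G1 Y Z g ∘ G1 X Y f.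
  apply: faiF; rewrite fmapM !invE -!compA; congr (_ ∘ (_ ∘ _)).
  by rewrite [t Y ∘ _]compA ts compIl.
pose G := Functor G1I G1M; exists G; split.
  pose r (X : C) : hom (G (F X)) X := inv (G (F X)) X (t (F X)).
  have isor X : iso (r X) by apply: (ff_iso faiF fulF); rewrite invE.
  exists r; split=> [X|X Y f]; first exact: isor.
  by apply: faiF; rewrite !fmapM !invE /= !compA ts compIl.
exists t; split=> [X|X Y f]; first exact: tiso.
by rewrite /= invE !compA ts compIl.
Qed.

Section EquivalencesPreserve.
Context {k : fieldType} {C D : linCat k} (F : functor C D).
Hypothesis eqvF : equivalence F.

Lemma equivalence_mono X Y (f : hom X Y) : mono f -> mono (fmap F f).
Proof.
move=> mf T u v Efuv; have [Z [w isow]] := equivalence_essSurj eqvF T.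
apply: (iso_epi isow).
have [u' u'E] := equivalence_full eqvF (u ∘ w).
have [v' v'E] := equivalence_full eqvF (v ∘ w).
rewrite -u'E -v'E; congr fmap; apply: mf.
by apply: (equivalence_faithful eqvF); rewrite !fmapM u'E v'E !compA Efuv.
Qed.

Lemma equivalence_epi X Y (f : hom X Y) : epi f -> epi (fmap F f).
Proof.
move=> mf T u v Efuv; have [Z [w isow']] := equivalence_essSurj eqvF T.
have [w' [w'w ww']] := isow'.
have isow : iso w' by exists w.
apply: (iso_mono isow).
have [u' u'E] := equivalence_full eqvF (w' ∘ u).
have [v' v'E] := equivalence_full eqvF (w' ∘ v).
rewrite -u'E -v'E; congr fmap; apply: mf.
by apply: (equivalence_faithful eqvF); rewrite !fmapM u'E v'E -!compA Efuv.
Qed.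

Lemma equivalence_projective X : projective (F X) -> projective X.
Proof.
move=> pFX Y Z e f epie.
have [g gE] := pFX _ _ _ (fmap F f) (equivalence_epi epie).
have [h hE] := equivalence_full eqvF g.
by exists h; apply: (equivalence_faithful eqvF); rewrite fmapM hE.
Qed.

End EquivalencesPreserve.

Section LinearFunctor.
Context {k : fieldType} {C D : linCat k} (F : functor C D).
Hypothesis linF : linearFunctor F.

Lemma fmapD X Y (f g : hom X Y) : fmap F (f + g) = fmap F f + fmap F g.
Proof. by rewrite -[f in LHS]scale1r linF scale1r. Qed.

Lemma fmap0 X Y : fmap F (0 : hom X Y) = 0.
Proof. by apply: (addIr (fmap F 0)); rewrite -fmapD !add0r. Qed.

Lemma fmapB X Y (f g : hom X Y) : fmap F (f - g) = fmap F f - fmap F g.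
Proof.
apply: (addIr (fmap F g)); rewrite -fmapD.
by rewrite !addrNK.
Qed.

Lemma fmap_zero X : isZero X -> isZero (F X).
Proof. by rewrite /isZero => X0; rewrite -fmapI X0 fmap0. Qed.

End LinearFunctor.

Section Abelian.
Context {k : fieldType} {C : linCat k}.
Hypothesis abC : abelian C.
Implicit Types X Y Z : C.

(** A mono is the kernel of some [g], and [g] vanishes when the mono is epi. *)
Lemma mono_epi_iso X Y (f : hom X Y) : mono f -> epi f -> iso f.
Proof.
have [_ _ _ mker _] := abC; move=> mf ef; have [Z [g kg]] := mker _ _ f mf.
have g0 : g = 0 by apply: (epi0 ef); case: kg.
have [|h fh] := kernel_lift (g := idc Y) kg; first by rewrite g0 comp0l.
by exists h; split=> //; apply: mf; rewrite compA fh compIl compIr.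
Qed.

Lemma epi_shortExact X Y Z (e : hom Y Z) (i : hom X Y) :
  epi e -> isKernel e i -> shortExact i e.
Proof.
have [_ _ _ _ eck] := abC; move=> ee ki; split=> //.
have [W [f cf]] := eck _ _ e ee.
apply: cokernelI; [by case: ki | by [] | move=> T g gi].
have [|t it] := kernel_lift (g := f) ki; first by case: cf.
by apply: (cokernel_desc cf); rewrite -it compA gi comp0l.
Qed.

Lemma mono_shortExact X Y Z (m : hom X Y) (c : hom Y Z) :
  mono m -> isCokernel m c -> shortExact m c.
Proof.
have [_ _ _ mk _] := abC; move=> mm cc; split=> //.
have [W [f kf]] := mk _ _ m mm.
apply: kernelI; [by case: cc | by [] | move=> T g gi].
have [|t it] := cokernel_desc (g := f) cc; first by case: kf.
by apply: (kernel_lift kf); rewrite -it -compA gi comp0r.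
Qed.

Lemma epi_exact X Y (e : hom X Y) :
  epi e -> exists K (i : hom K X), shortExact i e.
Proof.
have [_ kers _ _ _] := abC; move=> ee; have [K [i ki]] := kers _ _ e.
by exists K, i; apply: epi_shortExact.
Qed.

Lemma mono_exact X Y (m : hom X Y) :
  mono m -> exists Z (c : hom Y Z), shortExact m c.
Proof.
have [_ _ coks _ _] := abC; move=> mm; have [Z [c cc]] := coks _ _ m.
by exists Z, c; apply: mono_shortExact.
Qed.

Lemma projective_retraction X Y Z (i : hom X Y) (p : hom Y Z) :
  shortExact i p -> projective Z -> exists r, r ∘ i = idc X.
Proof.
move=> [ki cp] pZ; have [s ps] := projective_split (cokernel_epi cp) pZ.
have [|r ir] := kernel_lift (g := idc Y - s ∘ p) ki.
  by rewrite compBr compIr compA ps compIl subrr.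
exists r; apply: (kernel_mono ki).
by rewrite compA ir compBl compIl -compA (proj1 ki) comp0r subr0 compIr.
Qed.

(** The image is the kernel of the cokernel. A map [g] killing [e] has a
    kernel [n] such that [m ∘ n] is the kernel of some [h]; this [h] kills [f],
    so it factors through the cokernel of [f] and kills [m], which forces [n] to
    be split epi. *)
Lemma image_factor X Y (f : hom X Y) :
  exists I (m : hom I Y) (e : hom X I), [/\ mono m, epi e & f = m ∘ e].
Proof.
have [_ kers coks mk _] := abC.
have [Z [c cc]] := coks _ _ f; have [I [m km]] := kers _ _ c.
have [|e me] := kernel_lift (g := f) km; first by case: cc.
have mm := kernel_mono km; exists I, m, e; split=> //.
apply: epi0P => T g ge0; have [J [n kn]] := kers _ _ g.
have mn := kernel_mono kn.
have [e' ne'] := kernel_lift kn ge0.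
have [W [h kh]] := mk _ _ (m ∘ n) (mono_comp mm mn).
have [h' h'c] : exists h', h' ∘ c = h.
  by apply: (cokernel_desc cc); rewrite -me -ne' !compA -[h ∘ m ∘ n]compA (proj1 kh) comp0l.
have [|t mnt] := kernel_lift (g := m) kh.
  by rewrite -h'c -compA (proj1 km) comp0r.
have nt : n ∘ t = idc I by apply: mm; rewrite compA mnt compIr.
by rewrite -[g]compIr -nt compA (proj1 kn) comp0l.
Qed.

Lemma simple_mono X Y (f : hom X Y) : simple X -> f <> 0 -> mono f.
Proof.
have [_ kers _ _ _] := abC; move=> [_ sX] f0; have [K [i ki]] := kers _ _ f.
case: (sX _ _ (kernel_mono ki)) => [K0|isoi].
  apply: mono0P => Z g /(kernel_lift ki)[h <-].
  by rewrite (zero_cod h K0) comp0r.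
by case: f0; apply: (epi0 (iso_epi isoi)); case: ki.
Qed.

Lemma simple_epi X Y (f : hom X Y) : simple Y -> f <> 0 -> epi f.
Proof.
move=> [_ sY] f0; have [I [m [e [mm ee fE]]]] := image_factor f.
case: (sY _ _ mm) => [I0|isom].
  by case: f0; rewrite fE (zero_cod e I0) comp0r.
by rewrite fE; apply: epi_comp ee; apply: iso_epi.
Qed.

(** Schur's lemma. *)
Lemma simple_iso X Y (f : hom X Y) : simple X -> simple Y -> f <> 0 -> iso f.
Proof.
by move=> sX sY f0; apply: mono_epi_iso; [apply: simple_mono | apply: simple_epi].
Qed.

Lemma zero_object : exists X : C, isZero X.
Proof.
have [sums _ _ _ _] := abC.
have [X [i [p [_ _ sumX]]]] := sums 0%N (fun j => False_rect C (notF (ltn_ord j))).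
by exists X; rewrite /isZero -sumX big_ord0.
Qed.

Lemma binary_sum X Y : exists W (i : hom X W) (j : hom Y W) (p : hom W X) (q : hom W Y),
  [/\ p ∘ i = idc X, q ∘ j = idc Y, q ∘ i = 0, p ∘ j = 0 & i ∘ p + j ∘ q = idc W].
Proof.
have [sums _ _ _ _] := abC.
have [W [i [p [pi1 pi0 sumW]]]] := sums 2%N (fun j : 'I_2 => if j == ord0 then X else Y).
exists W, (i ord0), (i (lift ord0 ord0)), (p ord0), (p (lift ord0 ord0)).
split; [exact: (pi1 ord0) | exact: (pi1 (lift ord0 ord0)) | | |].
- exact: (pi0 ord0 (lift ord0 ord0)).
- exact: (pi0 (lift ord0 ord0) ord0).
- by rewrite -sumW big_ord_recl big_ord_recl big_ord0 addr0.
Qed.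

End Abelian.

Section ExactFunctor.
Context {k : fieldType} {C D : linCat k} (F : functor C D).
Hypotheses (abC : abelian C) (exF : exact F).

Lemma exact_mono X Y (f : hom X Y) : mono f -> mono (fmap F f).
Proof. by move=> /(mono_exact abC)[Z [c /exF[/kernel_mono]]]. Qed.

Lemma exact_epi X Y (f : hom X Y) : epi f -> epi (fmap F f).
Proof. by move=> /(epi_exact abC)[Z [c /exF[_ /cokernel_epi]]]. Qed.

End ExactFunctor.

Section Length.
Context {k : fieldType} {C : linCat k}.
Implicit Types X Y Z : C.

(** What inductions on length need; the dimension of a module is an example. *)
Definition lengthFunction (l : C -> nat) :=
  (forall (X Y : C) (f : hom X Y), mono f -> ~ iso f -> (l X < l Y)%N) /\
  (forall (X Y : C) (f : hom X Y), epi f -> ~ iso f -> (l Y < l X)%N).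

Hypothesis abC : abelian C.
Variable l : C -> nat.
Hypothesis lenl : lengthFunction l.

Lemma simple_subobject X : ~ isZero X -> exists S (m : hom S X), simple S /\ mono m.
Proof.
have [n] := ubnP (l X); elim: n X => // n IHn X lX X0.
have [sX|nsX] := EM (simple X).
  by exists X, (idc X); split=> //; apply/iso_mono/iso_id.
have [Y [m [mm Y0 nisom]]] : exists Y (m : hom Y X), [/\ mono m, ~ isZero Y & ~ iso m].
  apply: contrapT => noY; apply: nsX; split=> // Y m mm.
  apply: contrapT => /not_orP[Y0 nm]; apply: noY.
  by exists Y, m; split.
have [||S [i [sS mi]]] := IHn Y; [|by []|].
  by apply: (leq_trans _ (n := l X)) => //; apply: lenl.1 nisom.
by exists S, (m ∘ i); split=> //; apply: mono_comp.
Qed.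

(** Induction along simple subobjects: the form in which finite length is
    used throughout. *)
Lemma length_ind (Pr : C -> Prop) :
    (forall X, isZero X -> Pr X) ->
    (forall S X Y (i : hom S X) (p : hom X Y), simple S -> shortExact i p ->
       Pr Y -> Pr X) ->
  forall X, Pr X.
Proof.
move=> P0 PS X; have [n] := ubnP (l X); elim: n X => // n IHn X lX.
have [/P0//|X0] := EM (isZero X).
have [S [i [sS mi]]] := simple_subobject X0.
have [Y [p ex]] := mono_exact abC mi.
apply: (PS S X Y i p) => //; apply: IHn; apply: (leq_trans _ (n := l X)) => //.
apply: (lenl.2 _ _ p); first by case: ex => _ /cokernel_epi.
move=> isop; apply: sS.1; have [[pi _] _] := ex.
have i0 : i = 0 := mono0 (iso_mono isop) pi.
by apply: (mono0 mi); rewrite i0 comp0l.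
Qed.

End Length.

(** * Adjunctions and tensoring with a dualizable object *)

Section WeakAdjunction.
Context {k : fieldType} {C D : linCat k}.

(** An adjunction whose zigzag composites are isomorphisms instead of
    identities. This suffices for the preservation properties of adjoints, and
    for tensor functors it is obtained without the coherence theorem for units. *)
Definition weakAdjoint (L : functor C D) (R : functor D C) :=
  exists (eta : forall A : C, hom A (R (L A))) (eps : forall B : D, hom (L (R B)) B),
  [/\ forall (A A' : C) (f : hom A A'), fmap R (fmap L f) ∘ eta A = eta A' ∘ f,
      forall (B B' : D) (f : hom B B'), f ∘ eps B = eps B' ∘ fmap L (fmap R f),
      forall A, iso (eps (L A) ∘ fmap L (eta A))
    & forall B, iso (fmap R (eps B) ∘ eta (R B))].

Variables (L : functor C D) (R : functor D C).
Hypothesis adj : weakAdjoint L R.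

Lemma ladjoint_epi X Y (f : hom X Y) : epi f -> epi (fmap L f).
Proof.
case: adj => eta [eps [etaN epsN zigL zigR]] ef T u v uvf.
have {}uvf : fmap R u ∘ eta Y = fmap R v ∘ eta Y.
  by apply: ef; rewrite -!compA -!etaN !compA -!fmapM uvf.
apply: (iso_epi (zigL Y)); rewrite !compA !epsN -!compA -!fmapM.
by rewrite uvf.
Qed.

Lemma radjoint_mono X Y (f : hom X Y) : mono f -> mono (fmap R f).
Proof.
case: adj => eta [eps [etaN epsN zigL zigR]] mf T u v fuv.
have {}fuv : eps X ∘ fmap L u = eps X ∘ fmap L v.
  by apply: mf; rewrite !compA !epsN -!compA -!fmapM fuv.
apply: (iso_mono (zigR X)); rewrite -!compA -!etaN !compA -!fmapM.
by rewrite fuv.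
Qed.

Lemma ladjoint_projective P :
    (forall X Y (f : hom X Y), epi f -> epi (fmap R f)) ->
  projective P -> projective (L P).
Proof.
case: adj => eta [eps [etaN epsN zigL zigR]] epiR pP X Y e f /epiR eRe.
have [g gE] := pP _ _ _ (fmap R f ∘ eta P) eRe.
have [a [_ aK]] := zigL P.
exists (eps X ∘ fmap L g ∘ a).
rewrite !compA epsN -[_ ∘ fmap L g]compA -fmapM gE fmapM compA -epsN -!compA.
by rewrite [_ ∘ (_ ∘ a)]compA aK compIr.
Qed.

(** The hypothesis holds when [L] preserves monos and [I] is injective, but also
    for any [I] when [L] turns monos into split monos: this is the case of
    tensoring with a projective object, with [I] the unit. *)
Lemma radjoint_injective I :
    (forall X Y (m : hom X Y) (f : hom (L X) I), mono m ->
       exists g, g ∘ fmap L m = f) ->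
  injective_ob (R I).
Proof.
case: adj => eta [eps [etaN epsN zigL zigR]] extL X Y m f mm.
have [g gE] := extL _ _ _ (eps I ∘ fmap L f) mm.
have [a [aK _]] := zigR I.
exists (a ∘ (fmap R g ∘ eta Y)).
rewrite -!compA -etaN [fmap R g ∘ _]compA -fmapM gE fmapM -!compA etaN.
by rewrite !compA -[a ∘ _ ∘ eta _]compA aK compIl.
Qed.

Lemma ladjoint_cokernel (linL : linearFunctor L) (linR : linearFunctor R)
    X Y Z (f : hom X Y) (p : hom Y Z) :
  isCokernel f p -> isCokernel (fmap L f) (fmap L p).
Proof.
move=> cp; have ep := cokernel_epi cp.
apply: cokernelI; first by rewrite -fmapM (proj1 cp) fmap0.
  exact: ladjoint_epi.
case: adj => eta [eps [etaN epsN zigL zigR]] T g gLf.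
have [|h hp] := cokernel_desc (g := fmap R g ∘ eta Y) cp.
  by rewrite -compA -etaN compA -fmapM gLf fmap0 // comp0l.
have [a [aK Ka]] := zigL Z.
exists (eps T ∘ fmap L h ∘ a); have [b [bK Kb]] := zigL Y.
(* The zigzag composites are natural in the object. *)
have aN : a ∘ fmap L p = fmap L p ∘ b.
  apply: (iso_mono (zigL Z)); rewrite compA Ka compIl.
  have -> : eps (L Z) ∘ fmap L (eta Z) ∘ (fmap L p ∘ b)
          = fmap L p ∘ (eps (L Y) ∘ fmap L (eta Y)) ∘ b.
    by rewrite !compA epsN -!compA; congr comp; rewrite !compA -!fmapM etaN.
  by rewrite -compA Kb compIr.
rewrite -!compA aN [fmap L h ∘ _]compA -fmapM hp fmapM.
by rewrite !compA -epsN -!compA [eps _ ∘ _]compA Kb compIr.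
Qed.

End WeakAdjunction.

Section Tensor.
Context {k : fieldType} {C : linCat k} (M : monoidal C).
Local Notation I := (unitm M).
Local Notation "X ⊗ Y" := (tens (m := M) X Y).
Local Notation "f ⊠ g" := (tensh (m := M) f g).
Implicit Types X Y Z : C.

Lemma tenshMl X X' X'' Y (f' : hom X' X'') (f : hom X X') :
  (f' ∘ f) ⊠ idc Y = (f' ⊠ idc Y) ∘ (f ⊠ idc Y).
Proof. by rewrite -tenshM compIl. Qed.

Lemma tenshMr X Y Y' Y'' (g' : hom Y' Y'') (g : hom Y Y') :
  idc X ⊠ (g' ∘ g) = (idc X ⊠ g') ∘ (idc X ⊠ g).
Proof. by rewrite -tenshM compIl. Qed.

Lemma tensh_swap X X' Y Y' (f : hom X X') (g : hom Y Y') :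
  (idc X' ⊠ g) ∘ (f ⊠ idc Y) = (f ⊠ idc Y') ∘ (idc X ⊠ g).
Proof. by rewrite -!tenshM !compIl !compIr. Qed.

Lemma assocV_nat X X' Y Y' Z Z' (f : hom X X') (g : hom Y Y') (h : hom Z Z') :
  assocV X' Y' Z' ∘ (f ⊠ (g ⊠ h)) = ((f ⊠ g) ⊠ h) ∘ assocV X Y Z.
Proof.
rewrite -[LHS]compIr -(assocVK M X Y Z) compA -[in LHS](compA (assocV _ _ _)).
by rewrite -assoc_nat compA assocK compIl.
Qed.

Lemma assoc_iso X Y Z : iso (assoc (m := M) X Y Z).
Proof. by exists (assocV X Y Z); rewrite assocK assocVK. Qed.

Lemma assocV_iso X Y Z : iso (assocV (m := M) X Y Z).
Proof. by exists (assoc X Y Z); rewrite assocK assocVK. Qed.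

Lemma tensh_iso X X' Y Y' (f : hom X X') (g : hom Y Y') :
  iso f -> iso g -> iso (f ⊠ g).
Proof.
move=> [f' [f'f ff']] [g' [g'g gg']]; exists (f' ⊠ g').
by rewrite -!tenshM f'f ff' g'g gg' !tenshI.
Qed.

Definition ltensor X : functor C C :=
  @Functor k C C (fun Y => X ⊗ Y) (fun Y Z f => idc X ⊠ f)
    (fun Y => tenshI M X Y) (fun Y Z T g f => tenshMr X g f).

Lemma ltensor_lin X : bilinearTens M -> linearFunctor (ltensor X).
Proof. by move=> [_ lin] Y Z a f g; apply: lin. Qed.

Definition lunitV X : hom X (I ⊗ X) := projT1 (cid (lunit_iso M X)).

Lemma lunitVK X : lunit X ∘ lunitV X = idc X.
Proof. by case: (projT2 (cid (lunit_iso M X))). Qed.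

Lemma lunitK X : lunitV X ∘ lunit X = idc (I ⊗ X).
Proof. by case: (projT2 (cid (lunit_iso M X))). Qed.

Lemma lunitV_nat X Y (f : hom X Y) : lunitV Y ∘ f = (idc I ⊠ f) ∘ lunitV X.
Proof.
apply: (iso_mono (lunit_iso M Y)); rewrite !compA lunitVK compIl lunit_nat.
by rewrite -compA lunitVK compIr.
Qed.

(** The zigzag of the adjunction at [X ⊗ B] is the first triangle of the
    duality tensored with [B], up to unit constraints; by the pentagon and the
    triangle axiom. The zigzag at [Xd ⊗ A] is treated in the same way with the
    second triangle. Knowing both only up to an isomorphism avoids the coherence
    between [lunit (X ⊗ B)] and [lunit X ⊠ idc B]. *)
Lemma ltensor_adjoint X Xd ev coev :
  @leftDual k C M X Xd ev coev -> weakAdjoint (ltensor Xd) (ltensor X).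
Proof.
move=> [dX dXd].
exists (fun A => assoc X Xd A ∘ (coev ⊠ idc A) ∘ lunitV A).
exists (fun B => lunit B ∘ (ev ⊠ idc B) ∘ assocV Xd X B).
split=> [A A' f|B B' f|A|B] /=.
- rewrite !compA -assoc_nat tenshI -!compA lunitV_nat.
  by rewrite [(idc _ ⊠ f) ∘ _]compA tensh_swap -!compA.
- rewrite !compA -lunit_nat -!compA assocV_nat tenshI.
  by rewrite [(idc _ ⊠ f) ∘ _]compA tensh_swap -!compA.
- pose w := (assocV Xd X Xd ⊠ idc A) ∘ ((idc Xd ⊠ coev) ⊠ idc A).
  set z := _ ∘ _.
  have main : z ∘ (runit Xd ⊠ idc A) =
     lunit (Xd ⊗ A) ∘ assoc I Xd A ∘ ((ev ⊠ idc Xd) ⊠ idc A) ∘ w.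
    rewrite -triangle /z compA -[_ ∘ (idc Xd ⊠ lunit A)]compA -tenshMr.
    rewrite -[_ ∘ lunit A]compA lunitK compIr tenshMr -!compA -assoc_nat.
    have -> : (idc Xd ⊠ assoc X Xd A) ∘ (assoc Xd (X ⊗ Xd) A ∘ ((idc Xd ⊠ coev) ⊠ idc A))
       = assoc Xd X (Xd ⊗ A) ∘ assoc (Xd ⊗ X) Xd A ∘ w.
      rewrite -pentagon /w -!compA; congr (_ ∘ (_ ∘ _)).
      by rewrite compA -tenshMl assocVK tenshI compIl.
    clearbody w; rewrite !compA; congr (_ ∘ w).
    rewrite -[_ ∘ assocV _ _ _ ∘ _]compA assocK compIr -!compA; congr (_ ∘ _).
    by rewrite assoc_nat tenshI.
  have [r [rK Kr]] : iso (runit (m := M) Xd ⊠ idc A).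
    by apply: tensh_iso; [exact: (runit_iso M) | apply: iso_id].
  have -> : z = z ∘ (runit Xd ⊠ idc A) ∘ r by rewrite -compA Kr compIr.
  apply: iso_comp; last by exists (runit Xd ⊠ idc A).
  rewrite main -!compA; apply: iso_comp; first exact: (lunit_iso M).
  apply: iso_comp; first exact: assoc_iso.
  rewrite /w -!tenshMl; apply: tensh_iso; last exact: iso_id.
  have -> : (ev ⊠ idc Xd) ∘ (assocV Xd X Xd ∘ (idc Xd ⊠ coev)) = lunitV Xd ∘ runit Xd.
    by rewrite -dXd !compA lunitK compIl.
  apply: iso_comp; last exact: (runit_iso M).
  by exists (lunit Xd); rewrite lunitK lunitVK.
set z := _ ∘ _.
have main : z ∘ (lunit (X ⊗ B) ∘ assoc I X B) = lunit X ⊠ idc B.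
  rewrite /z !compA -[_ ∘ lunitV _ ∘ _]compA lunitK compIr -!compA.
  have -> : (coev ⊠ idc (X ⊗ B)) ∘ assoc I X B =
      assoc (X ⊗ Xd) X B ∘ ((coev ⊠ idc X) ⊠ idc B) by rewrite assoc_nat tenshI.
  rewrite [assoc X Xd (X ⊗ B) ∘ _]compA -pentagon !tenshMr -!compA.
  rewrite [(idc X ⊠ assocV _ _ _) ∘ _]compA -tenshMr assocK tenshI compIl.
  rewrite [(idc X ⊠ (ev ⊠ idc B)) ∘ _]compA -assoc_nat.
  by rewrite !compA triangle -!tenshMl dX.
have [t [tK Kt]] : iso (lunit (m := M) (X ⊗ B) ∘ assoc I X B).
  by apply: iso_comp; [exact: (lunit_iso M) | apply: assoc_iso].
have -> : z = z ∘ (lunit (X ⊗ B) ∘ assoc I X B) ∘ t by rewrite -compA Kt compIr.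
rewrite main; apply: iso_comp; last by exists (lunit (X ⊗ B) ∘ assoc I X B).
by apply: tensh_iso; [exact: (lunit_iso M) | apply: iso_id].
Qed.

End Tensor.

Section Reverse.
Context {k : fieldType} {C : linCat k} (M : monoidal C).

Fact rev_tenshM (X X' X'' Y Y' Y'' : C)
    (f' : hom X' X'') (f : hom X X') (g' : hom Y' Y'') (g : hom Y Y') :
  tensh (m := M) (g' ∘ g) (f' ∘ f) = tensh g' f' ∘ tensh g f.
Proof. exact: tenshM. Qed.

Fact rev_triangle (X Y : C) :
  tensh (m := M) (runit Y) (idc X) ∘ assocV Y (unitm M) X = tensh (idc Y) (lunit X).
Proof. by rewrite -triangle -compA assocVK compIr. Qed.

Fact rev_pentagon (W X Y Z : C) :
  tensh (m := M) (assocV Z Y X) (idc W) ∘ assocV Z (tens Y X) W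
    ∘ tensh (idc Z) (assocV Y X W)
  = assocV (tens Z Y) X W ∘ assocV Z Y (tens X W).
Proof.
have isoP : iso (assoc (m := M) Z Y (tens X W) ∘ assoc (tens Z Y) X W).
  by apply: iso_comp; apply: assoc_iso.
apply: (iso_mono isoP).
rewrite -[RHS]compA [X in _ = _ ∘ X]compA assocVK compIl assocVK.
rewrite -pentagon -!compA [X in _ ∘ (_ ∘ X)]compA -tenshMl assocVK tenshI compIl.
by rewrite [X in _ ∘ X]compA assocVK compIl -tenshMr assocVK tenshI.
Qed.

(** The opposite tensor product turns statements about tensoring on the left
    into statements about tensoring on the right. *)
Definition revMonoidal : monoidal C :=
  @Monoidal k C (unitm M) (fun X Y => tens (m := M) Y X)
    (fun X X' Y Y' f g => tensh (m := M) g f)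
    (fun X Y => tenshI M Y X) rev_tenshM
    (fun X Y Z => assocV (m := M) Z Y X) (fun X Y Z => assoc (m := M) Z Y X)
    (fun X Y Z => assocVK M Z Y X) (fun X Y Z => assocK M Z Y X)
    (fun X X' Y Y' Z Z' f g h => assocV_nat M h g f)
    (fun X => runit (m := M) X) (runit_iso M) (@runit_nat k C M)
    (fun X => lunit (m := M) X) (lunit_iso M) (@lunit_nat k C M)
    rev_triangle rev_pentagon.

Lemma rev_leftDual (X Xd : C) ev coev :
  @leftDual k C M X Xd ev coev -> @leftDual k C revMonoidal Xd X ev coev.
Proof. by move=> [dX dXd]; split. Qed.

Lemma rev_rigid : rigid M -> rigid revMonoidal.
Proof.
move=> rigM X; have [[Xd [ev [coev d]]] [Y [ev' [coev' d']]]] := rigM X.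
split; first by exists Y, ev', coev'; apply: rev_leftDual.
by exists Xd, ev, coev; apply: rev_leftDual.
Qed.

Lemma rev_bilinear : bilinearTens M -> bilinearTens revMonoidal.
Proof. by move=> [lin1 lin2]; split=> X X' Y Y' a f f' g /=; [apply: lin2 | apply: lin1]. Qed.

End Reverse.

(** * Modules over a finite-dimensional algebra *)

Section ModuleCategory.
Context {k : fieldType} {A : falgType k}.
Local Notation Mod := (fdModCat A).

Lemma fdModHomE (M N : Mod) (f : @hom k Mod M N) a x :
  fdmh_val f (fdm_act M a x) = fdm_act N a (fdmh_val f x).
Proof. by have /asboolP := fdmh_valP f; apply. Qed.

Lemma fdModHom_eq (M N : Mod) (f g : @hom k Mod M N) :
  (forall x, fdmh_val f x = fdmh_val g x) -> f = g.
Proof. by move=> fg; apply: val_inj; apply/lfunP. Qed.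

Lemma mkFdModHom (M N : fdMod A) (f : 'Hom(M, N)) :
  (forall a x, f (fdm_act M a x) = fdm_act N a (f x)) ->
  exists g : @hom k Mod M N, fdmh_val g = f.
Proof. by move=> fP; have fS := asboolT fP; exists (FdModHom fS). Qed.

Lemma fdMod_comp_val (M N P : Mod) (g : @hom k Mod N P) (f : @hom k Mod M N) x :
  fdmh_val (g ∘ f) x = fdmh_val g (fdmh_val f x).
Proof. by rewrite lfunE. Qed.

Fact regular_act1 : amull (1 : A) = \1%VF.
Proof. exact: amull1. Qed.

Fact regular_actM (a b : A) : amull (a * b) = (amull a \o amull b)%VF.
Proof. by apply/lfunP => x; rewrite !lfunE /= !lfunE /= mulrA. Qed.

Definition regularMod : fdMod A := @FdMod k A A (@amull k A : {linear A -> 'End(A)})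
   regular_act1 regular_actM.

Definition orbit (M : fdMod A) (x : M) (a : A) : M := fdm_act M a x.

Fact orbit_linear (M : fdMod A) (x : M) : linear (orbit x).
Proof. rewrite /orbit; by move=> c a b; rewrite linearP !lfunE /= !lfunE. Qed.

HB.instance Definition _ (M : fdMod A) (x : M) :=
  GRing.isLinear.Build k A M *:%R (orbit x) (@orbit_linear M x).

(** The regular module represents the forgetful functor. *)
Lemma regular_orbit (M : Mod) (x : fdm_space M) :
  exists f : @hom k Mod regularMod M, forall a, fdmh_val f a = fdm_act M a x.
Proof.
have [a y|f fE] := @mkFdModHom regularMod M (linfun (orbit x)).
  by rewrite [LHS]lfunE [X in fdm_act M a X]lfunE /= lfunE /= /orbit fdm_actM lfunE.
by exists f => a; rewrite fE lfunE.
Qed.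

(** Tested on maps from the regular module. *)
Lemma fdMod_mono_lker (M N : Mod) (f : @hom k Mod M N) :
  mono f -> lker (fdmh_val f) = 0%VS.
Proof.
move=> mf; apply/eqP/lker0P => x y fxy.
have [g gE] := regular_orbit x; have [h hE] := regular_orbit y.
have gh : g = h.
  apply: mf; apply: fdModHom_eq => a; rewrite !fdMod_comp_val gE hE.
  by rewrite !fdModHomE fxy.
have := congr1 (fun u : @hom k Mod regularMod M => fdmh_val u 1) gh.
by rewrite gE hE fdm_act1 !lfunE.
Qed.

(** The quotient of [N] by a submodule [U], carried by the vector space
    complement of [U], on which [A] acts through the projection along [U]. *)
Section Quotient.
Variables (N : fdMod A) (U : {vspace N}).
Hypothesis stableU : forall a x, x \in U -> fdm_act N a x \in U.

Let W := (U^C)%VS.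
Let pr : 'End(N) := (\1 - projv U)%VF.

Fact prE x : pr x = x - projv U x. Proof. by rewrite !lfunE /= !lfunE. Qed.

Fact prW x : pr x \in W. Proof. by rewrite prE memv_projC. Qed.

Fact prU x : x \in U -> pr x = 0.
Proof. by move=> Ux; rewrite prE projv_id // subrr. Qed.

Fact prD x : x - pr x \in U. Proof. by rewrite prE subKr memv_proj. Qed.

Fact pr_id x : x \in W -> pr x = x.
Proof.
move=> Wx; have : x \in lker (projv U) by rewrite lker_proj.
by rewrite memv_ker prE => /eqP ->; rewrite subr0.
Qed.

Fact pr_act a x : pr (fdm_act N a (pr x)) = pr (fdm_act N a x).
Proof.
apply/eqP; rewrite -subr_eq0 -linearB /= -linearB /=; apply/eqP/prU/stableU.
by rewrite -opprB rpredN prD.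
Qed.

Definition quot_act (a : A) : 'End(subvs_of W) :=
  (linfun (vsproj W) \o pr \o fdm_act N a \o linfun vsval)%VF.

Fact quot_actE a x : vsval (quot_act a x) = pr (fdm_act N a (vsval x)).
Proof.
rewrite /quot_act !comp_lfunE [X in vsval X]lfunE vsprojK ?prW //.
by rewrite [X in fdm_act N a X]lfunE.
Qed.

Fact quot_act_linear : linear quot_act.
Proof.
move=> c a b; apply/lfunP => x; apply: val_inj.
rewrite add_lfunE scale_lfunE [RHS]linearP /= !quot_actE [fdm_act N _]linearP.
by rewrite !(add_lfunE, lfunE) /= linearP /= scalerBr opprD addrACA.
Qed.

HB.instance Definition _ :=
  GRing.isLinear.Build k A 'End(subvs_of W) *:%R quot_act quot_act_linear.

Fact quot_act1 : quot_act 1 = \1%VF.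
Proof.
by apply/lfunP => x; apply: val_inj; rewrite /= quot_actE fdm_act1 !id_lfunE pr_id ?subvsP.
Qed.

Fact quot_actM a b : quot_act (a * b) = (quot_act a \o quot_act b)%VF.
Proof.
apply/lfunP => x; apply: val_inj; rewrite /= comp_lfunE !quot_actE.
by rewrite pr_act fdm_actM comp_lfunE.
Qed.

Definition quotMod : fdMod A :=
  @FdMod k A (subvs_of W) (quot_act : {linear A -> 'End(subvs_of W)})
   quot_act1 quot_actM.

Lemma quotMod_proj :
  exists q : @hom k Mod N quotMod, forall x, (fdmh_val q x == 0) = (x \in U).
Proof.
pose q0 : 'Hom(N, quotMod) := (linfun (vsproj W) \o pr)%VF.
have q0E x : vsval (q0 x) = pr x.
  by rewrite comp_lfunE (lfunE (vsproj W)) vsprojK ?prW.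
have [a x|q qE] := @mkFdModHom N quotMod q0.
  by apply: val_inj; rewrite [LHS]q0E [RHS](quot_actE a (q0 x)) q0E pr_act.
exists q => x; rewrite qE; apply/eqP/idP => [qx0|Ux].
  by have := prD x; rewrite -q0E qx0 subr0.
by apply: val_inj; rewrite [LHS]q0E prU.
Qed.

End Quotient.

(** The projection to the quotient by the image kills [f]. *)
Lemma fdMod_epi_limg (M N : Mod) (f : @hom k Mod M N) :
  epi f -> limg (fdmh_val f) = fullv.
Proof.
move=> ef.
have stab a x : x \in limg (fdmh_val f) -> fdm_act N a x \in limg (fdmh_val f).
  by move=> /memv_imgP[y _ ->]; rewrite -fdModHomE memv_img ?memvf.
have [q qE] := quotMod_proj stab.
have q0 : q = 0.
  apply: (epi0 ef); apply: fdModHom_eq => x.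
  rewrite fdMod_comp_val [RHS]lfunE /=; apply/eqP.
  by rewrite qE memv_img ?memvf.
by apply/vspaceP => x; rewrite memvf -qE q0 lfunE eqxx.
Qed.

Lemma fdMod_iso (M N : Mod) (f : @hom k Mod M N) :
  lker (fdmh_val f) = 0%VS -> limg (fdmh_val f) = fullv -> iso f.
Proof.
move=> kf If; have fV y : fdmh_val f ((fdmh_val f)^-1%VF y) = y.
  by rewrite limg_lfunVK // If memvf.
have Vf x : (fdmh_val f)^-1%VF (fdmh_val f x) = x by rewrite lker0_lfunK ?kf.
have [a x|g gE] := @mkFdModHom N M (fdmh_val f)^-1%VF.
  by rewrite -[x in LHS]fV -fdModHomE Vf.
by exists g; split; apply: fdModHom_eq => x; rewrite fdMod_comp_val gE ?fV ?Vf lfunE.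
Qed.

Lemma regular_projective : @projective k Mod regularMod.
Proof.
move=> M N e f /fdMod_epi_limg ee.
have /memv_imgP[x _ xE] : fdmh_val f 1 \in limg (fdmh_val e) by rewrite ee memvf.
have [g gE] := regular_orbit x; exists g; apply: fdModHom_eq => a.
rewrite fdMod_comp_val gE fdModHomE -xE -fdModHomE; congr (fdmh_val f _).
by rewrite /= lfunE /= mulr1.
Qed.

Lemma regular_nonzero : ~ @isZero k Mod regularMod.
Proof.
move=> /(congr1 (fun u : @hom k Mod regularMod regularMod => fdmh_val u 1)).
by rewrite /= !lfunE /= => /eqP; rewrite oner_eq0.
Qed.

Lemma fdMod_length : @lengthFunction k Mod (fun M => dim (fdm_space M)).
Proof.
split=> M N f.
  move=> /fdMod_mono_lker kf nf; rewrite ltnNge; apply/negP => NM; apply: nf.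
  apply: fdMod_iso => //; apply/eqP; rewrite eqEdim subvf /=.
  have := limg_ker_dim (fdmh_val f) fullv.
  by rewrite kf capv0 dimv0 add0n => ->; rewrite !dimvf.
move=> /fdMod_epi_limg If nf; rewrite ltnNge; apply/negP => MN; apply: nf.
apply: fdMod_iso => //; apply/eqP; rewrite -dimv_eq0.
have := limg_ker_dim (fdmh_val f) fullv.
rewrite capfv If !dimvf => E; move: MN; rewrite -E -[leqRHS]add0n leq_add2r.
by rewrite leqn0.
Qed.

End ModuleCategory.

Section FiniteCategory.
Context {k : fieldType} {C : linCat k}.
Hypothesis finC : finiteCat C.

Lemma finite_length : exists l : C -> nat, lengthFunction l.
Proof.
have [A [E [linE eqvE]]] := finC.
have [monol epil] := @fdMod_length k A.
have refl X Y (f : hom X Y) : ~ iso f -> ~ iso (fmap E f).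
  by move=> nf /(ff_iso (equivalence_faithful eqvE) (equivalence_full eqvE)).
exists (fun X => dim (fdm_space (E X))); split=> X Y f mf /refl nf.
  by apply: (monol _ _ (fmap E f)) => //; apply: equivalence_mono.
by apply: (epil _ _ (fmap E f)) => //; apply: equivalence_epi.
Qed.

(** The object corresponding to the regular module. *)
Lemma finite_nonzero_projective : exists P : C, projective P /\ ~ isZero P.
Proof.
have [A [E [linE eqvE]]] := finC.
have [P [t [t' [t't tt']]]] := equivalence_essSurj eqvE (@regularMod k A).
exists P; split.
  apply: (equivalence_projective eqvE).
  exact: (projective_retract t't (@regular_projective k A)).
move=> P0; apply: (@regular_nonzero k A).
apply: (zero_iso (f := t)); first by exists t'.
exact: fmap_zero.
Qed.

End FiniteCategory.

(** * Rigid categories: invertible objects, projective and injective objects *)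

Section RigidTensor.
Context {k : fieldType} {C : linCat k} (M : monoidal C).
Hypotheses (rigM : rigid M) (bilM : bilinearTens M).
Local Notation I := (unitm M).
Local Notation "X ⊗ Y" := (tens (m := M) X Y).
Local Notation "f ⊠ g" := (tensh (m := M) f g).
Implicit Types X Y Z P : C.

Lemma ltensor_mono X Y Z (f : hom Y Z) : mono f -> mono (idc X ⊠ f).
Proof.
have [[Xd [ev [coev dX]]] _] := rigM X.
exact: (radjoint_mono (ltensor_adjoint dX)).
Qed.

Lemma ltensor_epi X Y Z (f : hom Y Z) : epi f -> epi (idc X ⊠ f).
Proof.
have [_ [V [ev [coev dX]]]] := rigM X.
exact: (ladjoint_epi (ltensor_adjoint dX)).
Qed.

Lemma ltensor_cokernel X Y Z T (f : hom Y Z) (p : hom Z T) :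
  isCokernel f p -> isCokernel (idc X ⊠ f) (idc X ⊠ p).
Proof.
have [_ [V [ev [coev dX]]]] := rigM X.
by apply: (ladjoint_cokernel (ltensor_adjoint dX)); apply: ltensor_lin.
Qed.

Lemma ltensor_projective X P : projective P -> projective (X ⊗ P).
Proof.
have [_ [V [ev [coev dX]]]] := rigM X.
apply: (ladjoint_projective (ltensor_adjoint dX)) => Y Z f.
exact: ltensor_epi.
Qed.

Lemma ltensor_injective X J : injective_ob J -> injective_ob (X ⊗ J).
Proof.
have [[Xd [ev [coev dX]]] _] := rigM X; move=> injJ.
apply: (radjoint_injective (ltensor_adjoint dX)) => Y Z m f mm.
exact/injJ/ltensor_mono.
Qed.

Lemma ltensor_zero X Z : isZero Z -> isZero (X ⊗ Z).
Proof. by rewrite /isZero -tenshI => ->; apply: (fmap0 (ltensor_lin X bilM)). Qed.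

Lemma rtensor_zero X Z : isZero X -> isZero (X ⊗ Z).
Proof.
rewrite /isZero -tenshI => ->.
exact: (fmap0 (ltensor_lin (M := revMonoidal M) Z (rev_bilinear bilM))).
Qed.

Lemma tensh0l X X' Y Y' (g : hom Y Y') : (0 : hom X X') ⊠ g = 0.
Proof.
apply: (addIr (0 ⊠ g)); have := bilM.1 _ _ _ _ 1 (0 : hom X X') 0 g.
by rewrite !scale1r addr0 add0r => <-.
Qed.

End RigidTensor.

Section RightTensor.
Context {k : fieldType} {C : linCat k} (M : monoidal C).
Hypotheses (rigM : rigid M).

Lemma rtensor_epi (X Y Z : C) (f : hom Y Z) : epi f -> epi (tensh (m := M) f (idc X)).
Proof. exact: (ltensor_epi (rev_rigid rigM)). Qed.

Lemma rtensor_projective (X P : C) : projective P -> projective (tens (m := M) P X).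
Proof. exact: (ltensor_projective (rev_rigid rigM)). Qed.

End RightTensor.

Section InvertibleObjects.
Context {k : fieldType} {C : linCat k} (M : monoidal C).
Hypotheses (rigM : rigid M) (bilM : bilinearTens M).
Local Notation I := (unitm M).
Local Notation "X ⊗ Y" := (tens (m := M) X Y).
Local Notation "f ⊠ g" := (tensh (m := M) f g).
Implicit Types X Y Z P : C.

(** Invertibility without the duality data: it passes through any monoidal
    functor at once. *)
Definition tensorInvertible X :=
  exists Y, (exists f : hom (X ⊗ Y) I, iso f) /\ (exists g : hom (Y ⊗ X) I, iso g).

Lemma invertibleW X : invertible M X -> tensorInvertible X.
Proof.
move=> [Xd [ev [coev [_ isoev [c [cK Kc]]]]]]; exists Xd.
by split; [exists c, coev | exists ev].
Qed.

(** Tensoring with an invertible object [X] is undone by tensoring with its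
    inverse [Y], naturally. *)
Lemma ltensor_undo X Y (g : hom (Y ⊗ X) I) : iso g ->
  exists t : forall Z, hom (Y ⊗ (X ⊗ Z)) Z,
    (forall Z, iso (t Z)) /\
    forall Z W (m : hom Z W), t W ∘ (idc Y ⊠ (idc X ⊠ m)) = m ∘ t Z.
Proof.
move=> isog; exists (fun Z => lunit Z ∘ (g ⊠ idc Z) ∘ assocV Y X Z); split=> [Z|Z W m].
  apply: iso_comp; last exact: assocV_iso.
  by apply: iso_comp; [apply: (lunit_iso M) | apply: tensh_iso isog (iso_id _)].
rewrite !compA -lunit_nat -!compA assocV_nat tenshI.
by rewrite [(idc I ⊠ m) ∘ _]compA tensh_swap -!compA.
Qed.

Lemma tensorInvertible_zero X Z : tensorInvertible X -> isZero (X ⊗ Z) -> isZero Z.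
Proof.
move=> [Y [_ [g isog]]] XZ0; have [t [tiso _]] := ltensor_undo isog.
by apply: (zero_iso (tiso Z)); apply: ltensor_zero.
Qed.

Lemma tensorInvertible_iso X Z W (m : hom Z W) :
  tensorInvertible X -> iso (idc X ⊠ m) -> iso m.
Proof.
move=> [Y [_ [g isog]]] isoXm; have [t [tiso tnat]] := ltensor_undo isog.
apply: (iso_square (tiso Z) (tiso W) (tnat _ _ m)).
by apply: tensh_iso; first exact: iso_id.
Qed.

Lemma tensorInvertible_sym X : tensorInvertible X ->
  exists2 Y, tensorInvertible Y & exists g : hom (Y ⊗ X) I, iso g.
Proof. by move=> [Y [XY YX]]; exists Y => //; exists X. Qed.

(** If [S] is simple and invertible then tensoring with [S] embeds the
    subobjects of the unit into those of [S ⊗ I], which is [S]. *)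
Lemma unit_simple S : simple S -> tensorInvertible S -> simple I.
Proof.
move=> [S0 sS] invS; split=> [I0|Z m mm].
  by apply: S0; apply: (zero_iso (lunit_iso M S)); apply: rtensor_zero.
case: (sS (S ⊗ Z) (runit S ∘ (idc S ⊠ m))).
- by apply: mono_comp; [apply/iso_mono/runit_iso | apply: ltensor_mono].
- by move=> SZ0; left; apply: tensorInvertible_zero invS SZ0.
move=> isom; right; apply: (tensorInvertible_iso invS).
have [r [rK Kr]] := runit_iso M S.
have -> : idc S ⊠ m = r ∘ (runit S ∘ (idc S ⊠ m)) by rewrite compA rK compIl.
by apply: iso_comp isom; exists (runit S).
Qed.

Lemma tensorInvertible_simple X : simple I -> tensorInvertible X -> simple X.
Proof.
move=> [I0 sI] invX; have [Y invY [g isog]] := tensorInvertible_sym invX.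
split=> [X0|Z m mm].
  by apply: I0; apply: (zero_iso isog); apply: ltensor_zero.
case: (sI (Y ⊗ Z) (g ∘ (idc Y ⊠ m))).
- by apply: mono_comp; [apply/iso_mono | apply: ltensor_mono].
- by move=> YZ0; left; apply: tensorInvertible_zero invY YZ0.
move=> isom; right; apply: (tensorInvertible_iso invY).
have [r [rK Kr]] := isog.
have -> : idc Y ⊠ m = r ∘ (g ∘ (idc Y ⊠ m)) by rewrite compA rK compIl.
by apply: iso_comp isom; exists g.
Qed.

(** If [X] is projective, so is [X ⊗ Y], which is isomorphic to the
    unit [I], and then so is [I ⊗ P]. *)
Lemma tensorInvertible_projective X P :
  tensorInvertible X -> projective X -> projective P.
Proof.
move=> [Y [[f isof] _]] pX.
apply: (projective_iso (lunit_iso M P)); apply: (rtensor_projective rigM).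
by apply: (projective_iso isof); apply: (rtensor_projective rigM).
Qed.

End InvertibleObjects.

Section Frobenius.
Context {k : fieldType} {C : linCat k} (M : monoidal C).
Hypotheses (abC : abelian C) (rigM : rigid M) (bilM : bilinearTens M).
Local Notation I := (unitm M).
Local Notation "X ⊗ Y" := (tens (m := M) X Y).
Local Notation "f ⊠ g" := (tensh (m := M) f g).
Implicit Types X Y Z P : C.
Hypothesis simpleI : simple I.
Hypothesis proj0 : exists P : C, projective P /\ ~ isZero P.

Lemma leftDual_ev_neq0 X Xd ev coev :
  @leftDual k C M X Xd ev coev -> ~ isZero Xd -> ev <> 0.
Proof.
move=> [_ dXd] Xd0 ev0; apply: Xd0; rewrite /isZero.
by apply: (epi0 (iso_epi (runit_iso M Xd))); rewrite compIl -dXd ev0 tensh0l // comp0r !comp0l.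
Qed.

(** A map from [Z] to [Y] corresponds to a map from [Q ⊗ Z] to the unit. For a
    mono [m : Z -> W] with cokernel [D], the cokernel of [Q ⊗ m] is [Q ⊗ D],
    which is projective with [Q]; so [Q ⊗ m] splits and the map extends. *)
Lemma dual_projective_injective Q Y ev coev :
  @leftDual k C M Y Q ev coev -> projective Q -> injective_ob Y.
Proof.
move=> dY pQ; have [r [rK Kr]] := runit_iso M Y.
apply: (injective_retract Kr).
apply: (radjoint_injective (ltensor_adjoint dY)) => Z W m f mm.
have [D [c exm]] := mono_exact abC mm.
have [p pE] : exists p, p ∘ (idc Q ⊠ m) = idc _.
  apply: (projective_retraction (p := idc Q ⊠ c)); last exact: rtensor_projective.
  apply: mono_shortExact => //; first exact: ltensor_mono.
  by apply: ltensor_cokernel => //; case: exm.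
by exists (f ∘ p); rewrite -compA pE compIr.
Qed.

(** [Q ⊗ Y] is projective because [Q] is, injective because [Y] is, and the
    evaluation is nonzero, hence epi onto the simple unit. *)
Lemma projective_injective_cover : exists E (e : hom E I),
  [/\ projective E, injective_ob E & epi e].
Proof.
have [Q [pQ Q0]] := proj0; have [_ [Y [ev [coev dY]]]] := rigM Q.
exists (Q ⊗ Y), ev; split; first exact: rtensor_projective.
  by apply: ltensor_injective => //; apply: dual_projective_injective dY pQ.
by apply: simple_epi => //; apply: (leftDual_ev_neq0 dY).
Qed.

Lemma enough_projectives X : exists P (e : hom P X), projective P /\ epi e.
Proof.
have [E [e [pE _ ee]]] := projective_injective_cover.
exists (E ⊗ X), (lunit X ∘ (e ⊠ idc X)); split; first exact: rtensor_projective.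
by apply: epi_comp; [apply/iso_epi/lunit_iso | apply: rtensor_epi].
Qed.

(** [P ⊗ E] is injective and maps onto [P], which is therefore a direct
    summand. *)
Lemma projective_injective P : projective P -> injective_ob P.
Proof.
have [E [e [_ iE ee]]] := projective_injective_cover; move=> pP.
have [|s sE] := projective_split (e := runit P ∘ (idc P ⊠ e)) _ pP.
  by apply: epi_comp; [apply/iso_epi/runit_iso | apply: ltensor_epi].
by apply: (injective_retract sE); apply: ltensor_injective.
Qed.

End Frobenius.

(** * Semisimplicity from projectivity *)

Section Semisimple.
Context {k : fieldType} {C : linCat k}.
Implicit Types X Y Z P : C.

Lemma isDirectSum0 X (S : 'I_0 -> C) : isZero X -> isDirectSum S X.
Proof.
by move=> X0; exists (fun j => 0), (fun j => 0); split=> [[]//|[]//|]; rewrite big_ord0 X0.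
Qed.

Definition consFam n X (S : 'I_n -> C) (j : 'I_n.+1) : C := oapp S X (unlift ord0 j).

Lemma isDirectSum_cons n (S : 'I_n -> C) X Y Z (i : hom X Y) (p : hom Y Z)
    (r : hom Y X) (s : hom Z Y) :
    r ∘ i = idc X -> p ∘ s = idc Z -> p ∘ i = 0 -> r ∘ s = 0 ->
    i ∘ r + s ∘ p = idc Y ->
  isDirectSum S Z -> isDirectSum (consFam X S) Y.
Proof.
move=> ri ps pi0 rs0 sumY [u [v [vu vu0 sumZ]]].
pose in_ (o : option 'I_n) : hom (oapp S X o) Y :=
  if o is Some j then s ∘ u j else i.
pose pr_ (o : option 'I_n) : hom Y (oapp S X o) :=
  if o is Some j then v j ∘ p else r.
exists (fun j => in_ (unlift ord0 j)), (fun j => pr_ (unlift ord0 j)); split.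
- move=> j; rewrite /consFam; case: unliftP => [j' _|_] //=.
  by rewrite -compA [p ∘ _]compA ps compIl vu.
- move=> j l; rewrite /consFam; case: (unliftP ord0 j) => [j' ->|->];
    case: (unliftP ord0 l) => [l' ->|->] //=.
  + rewrite (inj_eq lift_inj) => ne.
    by rewrite -compA [p ∘ _]compA ps compIl vu0.
  + by move=> _; rewrite compA rs0 comp0l.
  + by move=> _; rewrite -compA pi0 comp0r.
- pose e o := in_ o ∘ pr_ o; rewrite (eq_bigr (fun j => e (unlift ord0 j))) //.
  rewrite big_ord_recl unlift_none /= -sumY; congr (_ + _).
  rewrite -[s in RHS]compIr -sumZ comp_sumr comp_suml.
  by apply: eq_bigr => j _; rewrite liftK /e /= !compA.
Qed.

(** A simple subobject splits off when its quotient is projective. *)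
Lemma all_projective_semisimple (l : C -> nat) :
    abelian C -> lengthFunction l -> (forall X : C, projective X) -> semisimple C.
Proof.
move=> abC lenl proj; apply: (length_ind abC lenl) => [X X0|S X Y i p sS exS [n [T [sT sumT]]]].
  by exists 0%N, (fun _ => X); split=> [[]//|]; apply: isDirectSum0.
have [r ri] := projective_retraction exS (proj Y).
have [ki cp] := exS; have [|s ps] := cokernel_desc (g := idc X - i ∘ r) cp.
  by rewrite compBl compIl -compA ri compIr subrr.
have ep := cokernel_epi cp; have pi0 : p ∘ i = 0 by case: ki.
exists n.+1, (consFam S T); split.
  by move=> j; rewrite /consFam; case: (unlift ord0 j).
apply: (isDirectSum_cons (i := i) (p := p) (r := r) (s := s)) => //.
- by apply: ep; rewrite -compA ps compBr compA pi0 comp0l subr0 compIr compIl.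
- by apply: ep; rewrite -compA ps compBr compIr compA ri compIl subrr comp0l.
- by rewrite ps addrC subrK.
Qed.

End Semisimple.

(** * Dévissage along exact functors *)

Section SimpleStableMaps.
Context {k : fieldType} {C : abCat k}.
Hypothesis enoughProj : forall X : C, exists P (e : hom P X), projective P /\ epi e.
Hypothesis projInj : forall P : C, projective P -> injective_ob P.
Variable l : C -> nat.
Hypothesis lenl : lengthFunction l.

(** If all maps from simple objects to [X] are stably zero, they lift to a
    projective [P] mapping onto [X]. Since [P] is injective, lifts extend from a
    simple subobject of [Z] to [Z], so all maps from any [Z] lift, by induction on
    length; lifting the identity makes [X] a direct summand of [P]. *)
Lemma simple_not_stably_zero (X : C) : ~ projective X ->
  exists (S : C) (s : hom S X), simple S /\ ~ factorsProj s.
Proof.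
move=> npX; apply: contrapT => none; apply: npX.
have [P [e [pP ee]]] := enoughProj X.
suff lifts Z : forall f : hom Z X, exists g, e ∘ g = f.
  by have [s es] := lifts X (idc X); apply: (projective_retract es).
elim/(length_ind (abCatP C) lenl): Z => [Z Z0 f|S Z W i p sS [ki cp] IHW f].
  by exists 0; rewrite comp0r (zero_dom f Z0).
have [g eg] : exists g, e ∘ g = f ∘ i.
  have [Q [b [a [pQ ->]]]] : factorsProj (f ∘ i).
    by apply: contrapT => nf; apply: none; exists S, (f ∘ i).
  by have [b' <-] := pQ _ _ e b ee; exists (b' ∘ a); rewrite compA.
have [g' g'i] := projInj pP g (kernel_mono ki).
have [|h hp] := cokernel_desc (g := f - e ∘ g') cp.
  by rewrite compBl -compA g'i eg subrr.
have [h' eh'] := IHW h; exists (g' + h' ∘ p).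
by rewrite compDr compA eh' hp addrC subrK.
Qed.

End SimpleStableMaps.

Section Devissage.
Context {k : fieldType} {C D : abCat k} (F : functor C D).
Hypotheses (linF : linearFunctor F) (exF : exact F) (projF : preservesProj F).
Hypothesis enoughProj : forall X : C, exists P (e : hom P X), projective P /\ epi e.
Variables (l : C -> nat) (l' : D -> nat).
Hypotheses (lenl : lengthFunction l) (lenl' : lengthFunction l').

(** The image of a nonzero map contains a simple object, on which [F] does
    not vanish. *)
Lemma exact_faithful :
  (forall S : C, simple S -> ~ isZero (F S)) -> faithful F.
Proof.
move=> simpleF; suff F0 (X Y : C) (f : hom X Y) : fmap F f = 0 -> f = 0.
  by move=> X Y f g fg; apply/subr0_eq/F0; rewrite fmapB // fg subrr.
have [J [m [e [mm ee ->]]]] := image_factor (abCatP C) f.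
rewrite fmapM => Fme; suff J0 : isZero J by rewrite (zero_cod e J0) comp0r.
apply: contrapT => J0.
have [S [i [sS mi]]] := simple_subobject lenl J0.
apply: (simpleF S sS); have FJ0 : isZero (F J).
  apply: (mono0 (exact_mono (abCatP C) exF mm)); rewrite compIr.
  exact: (epi0 (exact_epi (abCatP C) exF ee)).
exact: (mono_zero (exact_mono (abCatP C) exF mi)).
Qed.

Hypothesis faiF : faithful F.
Hypothesis projInj : forall P : C, projective P -> injective_ob P.
Hypothesis stableFaithful :
  forall (X Y : C) (f : hom X Y), factorsProj (fmap F f) -> factorsProj f.

Definition fullAt (X Y : C) := forall f : hom (F X) (F Y), exists g, fmap F g = f.

(** The surjective half of the five lemma. Cover [X''] by a projective [P] with
    kernel [K], so that [X] is the pushout of [X'] and [P] along [K]. The map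
    [K -> X' -> Y] has an image under [F] that factors through [F P], so it is
    stably zero and extends to [v : P -> Y]. Correcting [v] by a map on [X'']
    makes it agree with [f] on [F P]; then [f] is determined on the epimorphism
    from [X' ⊕ P] onto [X] by maps in the image of [F], and faithfulness of [F]
    lets these descend to [X]. *)
Lemma fullAt_extension (X' X X'' Y : C) (i : hom X' X) (p : hom X X'') :
  shortExact i p -> fullAt X' Y -> fullAt X'' Y -> fullAt X Y.
Proof.
move=> [ki cp] fulX' fulX'' f; have [g gE] := fulX' (f ∘ fmap F i).
have [P [pi [pP epi_pi]]] := enoughProj X''.
have [K [j exK]] := epi_exact (abCatP C) epi_pi; have [kj cpi] := exK.
have [t tE] := pP _ _ p pi (cokernel_epi cp).
have [|c cE] := kernel_lift (g := t ∘ j) ki; first by rewrite compA tE; case: kj.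
have [v vE] : exists v, v ∘ j = g ∘ c.
  have [Q [b [a [pQ ->]]]] : factorsProj (g ∘ c).
    apply: stableFaithful; exists (F P), (f ∘ fmap F t), (fmap F j).
    by split; [apply: projF | rewrite fmapM gE -!compA -!fmapM cE].
  have [a' <-] := projInj pQ a (kernel_mono kj).
  by exists (b ∘ a'); rewrite compA.
(* The defect of [v] against [f] vanishes on [F K], hence comes from [X'']. *)
have [w [w' w'E]] : exists w : hom (F X'') (F Y),
    exists2 w', fmap F w' = w & w ∘ fmap F pi = f ∘ fmap F t - fmap F v.
  have [|w wE] := cokernel_desc (g := f ∘ fmap F t - fmap F v) (proj2 (exF exK)).
    by rewrite compBl -!compA -!fmapM vE -cE !fmapM compA -gE subrr.
  by have [w' w'E] := fulX'' w; exists w, w'.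
rewrite -w'E -fmapM => wE; pose v' := w' ∘ pi + v.
have v'E : fmap F v' = f ∘ fmap F t by rewrite fmapD // wE subrK.
have [W [i0 [j0 [p0 [q0 [p0i q0j q0i p0j _]]]]]] := binary_sum (abCatP C) X' P.
pose q := i ∘ p0 + t ∘ q0; pose h0 := g ∘ p0 + v' ∘ q0.
have epi_q : epi q.
  apply: epi0P => T r rq.
  have ri : r ∘ i = 0.
    have := congr1 (fun u => u ∘ i0) rq.
    by rewrite /= /q comp0l compDr compDl -!compA p0i q0i !comp0r addr0 compIr.
  have rt : r ∘ t = 0.
    have := congr1 (fun u => u ∘ j0) rq.
    by rewrite /= /q comp0l compDr compDl -!compA p0j q0j !comp0r add0r compIr.
  have [r' r'p] := cokernel_desc cp ri.
  by rewrite -r'p (epi0 epi_pi (g := r')) ?comp0l // -tE compA r'p.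
have Fh0 : fmap F h0 = f ∘ fmap F q.
  by rewrite !fmapD // !fmapM gE v'E compDr !compA.
have [N [n [kn cn]]] := epi_exact (abCatP C) epi_q.
have [|h hE] := cokernel_desc (g := h0) cn.
  by apply: faiF; rewrite fmapM Fh0 -compA -fmapM (proj1 kn) !fmap0 // comp0r.
exists h; apply: (exact_epi (abCatP C) exF epi_q).
by rewrite -fmapM hE.
Qed.

(** [fullAt_extension] varies the source, with a simple target. Over a
    projective source, maps lift along epimorphisms, so the target can be
    varied without any condition on extensions. A general source is a cokernel
    of a map into a projective object, and faithfulness concludes. *)
Lemma full_of_simple :
  (forall S T : C, simple S -> simple T -> fullAt S T) -> full F.
Proof.
move=> fulS.
have fulT X T : simple T -> fullAt X T.
  move=> sT; elim/(length_ind (abCatP C) lenl): X => [X X0 f|S X Y i p sS ex].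
    by exists 0; rewrite fmap0 // (zero_dom f) //; apply: fmap_zero.
  by apply: fullAt_extension ex _; apply: fulS.
have fulP P Y : projective P -> fullAt P Y.
  move=> pP; elim/(length_ind (abCatP C) lenl): Y => [X X0 f|S X Y i p sS ex IHY f].
    by exists 0; rewrite fmap0 // (zero_cod f) //; apply: fmap_zero.
  have [g gE] := IHY (fmap F p ∘ f).
  have [g' g'E] := pP _ _ p g (cokernel_epi (proj2 ex)).
  have [|u uE] := kernel_lift (g := f - fmap F g') (proj1 (exF ex)).
    by rewrite compBr -fmapM g'E gE subrr.
  have [u' u'E] := fulT P S sS u; exists (i ∘ u' + g').
  by rewrite fmapD // fmapM u'E uE subrK.
move=> X Y f; have [P [e [pP ee]]] := enoughProj X.
have [K [j [kj cj]]] := epi_exact (abCatP C) ee.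
have [g gE] := fulP P Y pP (f ∘ fmap F e).
have [|h hE] := cokernel_desc (g := g) cj.
  by apply: faiF; rewrite fmapM gE -compA -fmapM (proj1 kj) !fmap0 // comp0r.
by exists h; apply: (exact_epi (abCatP C) exF ee); rewrite -fmapM hE.
Qed.

(** A quotient of [F X] lifted along an extension needs a projective source,
    which is why [X] is replaced by a projective cover [P] below. *)
Lemma essSurj_of_simple : full F ->
  (forall T : D, simple T -> exists (S : C) (f : hom (F S) T), iso f) -> essSurj F.
Proof.
move=> fulF essS.
have quotF (Y : D) : exists (X : C) (e : hom (F X) Y), epi e.
  elim/(length_ind (abCatP D) lenl'): Y => [Y Y0|T Y Z i p sT [ki cp] [X [e ee]]].
    have [X _] := zero_object (abCatP C); exists X, 0 => U g h _.
    by rewrite (zero_dom g Y0) (zero_dom h Y0).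
  have [S [a isoa]] := essS T sT; have [P [r [pP er]]] := enoughProj X.
  have [b bE] := projF pP (e ∘ fmap F r) (cokernel_epi cp).
  have [W [i0 [j0 [p0 [q0 [p0i q0j q0i p0j _]]]]]] := binary_sum (abCatP C) S P.
  exists W, (i ∘ a ∘ fmap F p0 + b ∘ fmap F q0); apply: epi0P => U g gW.
  have gi : g ∘ i = 0.
    apply: (epi0 (iso_epi isoa)).
    have := congr1 (fun u => u ∘ fmap F i0) gW.
    rewrite /= comp0l compDr compDl -!compA -!fmapM p0i q0i fmap0 // fmapI.
    by rewrite !comp0r addr0 compIr.
  have gb : g ∘ b = 0.
    have := congr1 (fun u => u ∘ fmap F j0) gW.
    rewrite /= comp0l compDr compDl -!compA -!fmapM p0j q0j fmap0 // fmapI.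
    by rewrite !comp0r add0r compIr.
  have [h hp] := cokernel_desc cp gi.
  have epi_er : epi (e ∘ fmap F r) := epi_comp ee (exact_epi (abCatP C) exF er).
  by rewrite -hp (epi0 epi_er (g := h)) ?comp0l // -bE compA hp.
move=> Y; have [X [e ee]] := quotF Y.
have [K [i exK]] := epi_exact (abCatP D) ee; have [ki ci] := exK.
have [X1 [e1 ee1]] := quotF K; have [d dE] := fulF _ _ (i ∘ e1).
have [N [m [s [mm es dms]]]] := image_factor (abCatP C) d.
have [Q [q exm]] := mono_exact (abCatP C) mm; have [kFm cFq] := exF exm.
have [|u uE] := cokernel_desc (g := fmap F q) ci.
  apply: (epi0 ee1); rewrite -compA -dE -fmapM dms compA.
  by rewrite (proj1 (proj1 exm)) comp0l fmap0.
(* [e] kills the image of [F m] because [s] is epi, so it is inverse to [u]. *)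
have [|w wE] := cokernel_desc (g := e) cFq.
  apply: (epi0 (exact_epi (abCatP C) exF es)); rewrite -compA -fmapM -dms dE.
  by rewrite compA (proj1 ki) comp0l.
exists Q, w, u; split.
  by apply: (cokernel_epi cFq); rewrite -compA wE uE compIl.
by apply: ee; rewrite -compA uE wE compIl.
Qed.

End Devissage.

(** * Consequences of a stable equivalence *)

Section StableEquivalence.
Context {k : fieldType} {C D : abCat k} (F : functor C D).
Hypotheses (linF : linearFunctor F) (projF : preservesProj F).
Hypothesis eqvF : equivalence (stableFunctor linF projF).

Lemma stable_faithful (X Y : C) (f : hom X Y) :
  factorsProj (fmap F f) -> factorsProj f.
Proof.
move=> Ff; have f0 : stableClass f = stableClass (0 : hom X Y).
  apply: (equivalence_faithful eqvF); rewrite /= !(stableMapE linF projF).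
  by apply/stableClass_eq; rewrite -fmapB // subr0.
by move/stableClass_eq: f0; rewrite subr0.
Qed.

Lemma stable_full (X Y : C) (f : hom (F X) (F Y)) :
  exists g, factorsProj (f - fmap F g).
Proof.
have [g gE] := @equivalence_full k _ _ _ eqvF X Y (stableClass f).
exists (lmodRepr (g : stableHom (X : C) Y)); apply/stableClass_eq.
by rewrite -gE.
Qed.

Lemma stable_essSurj (T : D) :
  exists (X : C) (a : hom (F X) T) (b : hom T (F X)),
    factorsProj (a ∘ b - idc T) /\ factorsProj (b ∘ a - idc (F X)).
Proof.
have [X [a [b [ba ab]]]] := equivalence_essSurj eqvF T.
have cl (U V : D) (f : stableHom U V) : exists g, f = stableClass g.
  by exists (lmodRepr f); rewrite /stableClass lmodReprK.
have [a' a'E] := cl _ _ (a : stableHom (F X : D) T).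
have [b' b'E] := cl _ _ (b : stableHom (T : D) (F X)).
exists X, a', b'; split; apply/stableClass_eq; rewrite -stableCompE -a'E -b'E.
  exact: ab.
exact: ba.
Qed.

(** A nonprojective simple object of the target is reached by a nonprojective
    object [X] up to a stable isomorphism [a]; a simple object [S] with a stably
    nonzero map [s] to [X] then has [a ∘ F s] nonzero. *)
Lemma simple_image (T : D) :
    (forall X : C, ~ projective X ->
      exists (S : C) (s : hom S X), simple S /\ ~ factorsProj s) ->
    (forall S : C, simple S -> simple (F S)) ->
    simple T -> ~ projective T ->
  exists (S : C) (f : hom (F S) T), iso f.
Proof.
move=> mapS simpleF sT npT; have [X [a [b [Pab Pba]]]] := stable_essSurj T.
have npX : ~ projective X.
  move=> pX; apply: npT; have pFX := projF pX.
  have [P [v [u [pP vu]]]] : factorsProj (idc T).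
    have -> : idc T = a ∘ b - (a ∘ b - idc T) by rewrite subKr.
    apply/factorsProjP/rpredB; apply/factorsProjP => //.
    by exists (F X), a, b.
  exact: (projective_retract (esym vu)).
have [S [s [sS nPs]]] := mapS X npX.
exists S, (a ∘ fmap F s); apply: (simple_iso (abCatP D)) => //; first exact: simpleF.
move=> as0; apply/nPs/stable_faithful.
have -> : fmap F s = b ∘ (a ∘ fmap F s) - (b ∘ a - idc (F X)) ∘ fmap F s.
  by rewrite compBl compIl compA subKr.
rewrite as0 comp0r; apply/factorsProjP/rpredB; first exact: rpred0.
by apply/factorsProjP; apply: factorsProj_compr.
Qed.

Lemma stable_full_simple (S T : C) :
    simple (F S) -> simple (F T) -> ~ projective (F S) ->
  forall f : hom (F S) (F T), exists g, fmap F g = f.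
Proof.
move=> sS sT npS f; have [g Pfg] := stable_full f; exists g.
apply: contrapT => ne; apply: npS; case: Pfg => P [v [u [pP vu]]].
apply: (iso_projective_factor (v := v) (u := u)) => //; rewrite -vu.
by apply: (simple_iso (abCatP D)) => // /subr0_eq ?; apply: ne.
Qed.

End StableEquivalence.

Lemma monFunctor_tensorInvertible (k : fieldType) (C D : linCat k)
    (M : monoidal C) (N : monoidal D) (F : monFunctor M N) (X : C) :
  tensorInvertible M X -> tensorInvertible N (F X).
Proof.
have [e [eK Ke]] := mf_unit_iso F.
have img (Y Z : C) (f : hom (tens (m := M) Y Z) (unitm M)) : iso f ->
    exists g : hom (tens (m := N) (F Y) (F Z)) (unitm N), iso g.
  move=> isof; exists (e ∘ fmap F f ∘ mf_tens F Y Z).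
  apply: iso_comp (mf_tens_iso F Y Z).
  by apply: iso_comp (fmap_iso F isof); exists (mf_unit F).
move=> [Y [[f isof] [g isog]]]; exists (F Y).
by split; [apply: img isof | apply: img isog].
Qed.

(** * Tensor categories with invertible simple objects *)

Section PointedTensorCategory.
Context {k : fieldType} (C : finTensCat k).
Local Notation M := (ftc_monoidal C).
Hypothesis invC : forall X : C, simple X -> invertible M X.

Lemma pointed_unit_simple : simple (unitm M).
Proof.
have [l lenl] := finite_length (ftc_finite C).
have [P [_ P0]] := finite_nonzero_projective (ftc_finite C).
have [S [i [sS _]]] := simple_subobject lenl P0.
apply: (unit_simple (@ftc_rigid _ C) (ftc_bilinear C) sS).
exact/invertibleW/invC.
Qed.

Lemma pointed_enough_projectives (X : C) :
  exists P (e : hom P X), projective P /\ epi e.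
Proof.
apply: (enough_projectives (abCatP C) (@ftc_rigid _ C) (ftc_bilinear C) pointed_unit_simple).
exact: finite_nonzero_projective (ftc_finite C).
Qed.

Lemma pointed_projective_injective (P : C) : projective P -> injective_ob P.
Proof.
apply: (projective_injective (abCatP C) (@ftc_rigid _ C) (ftc_bilinear C) pointed_unit_simple).
exact: finite_nonzero_projective (ftc_finite C).
Qed.

Lemma invertible_nonprojective (X : C) :
  ~ semisimple C -> tensorInvertible M X -> ~ projective X.
Proof.
move=> nss invX pX; apply: nss; have [l lenl] := finite_length (ftc_finite C).
apply: (all_projective_semisimple (abCatP C) lenl) => P.
exact: (tensorInvertible_projective (@ftc_rigid _ C) invX).
Qed.

End PointedTensorCategory.

Theorem proposition1p1 (k : closedFieldType) (C C' : finTensCat k)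
    (C_nss : ~ semisimple C) (C'_nss : ~ semisimple C')
    (F : monFunctor (ftc_monoidal C) (ftc_monoidal C'))
    (F_lin : linearFunctor F) (F_exact : exact F)
    (F_stable : inducesStableEquivalence F_lin)
    (C_inv : forall X : C, simple X -> invertible (ftc_monoidal C) X)
    (C'_inv : forall X : C', simple X -> invertible (ftc_monoidal C') X) :
  tensorEquivalence F.
Proof.
case: F_stable => projF eqvF; split=> //.
have [l lenl] := finite_length (ftc_finite C).
have [l' lenl'] := finite_length (ftc_finite C').
have enoughC := pointed_enough_projectives C_inv.
have injC := pointed_projective_injective C_inv.
have simple1' := pointed_unit_simple C'_inv.
have invF (S : C) : simple S -> tensorInvertible (ftc_monoidal C') (F S).
  by move=> /C_inv/invertibleW/monFunctor_tensorInvertible.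
have simpleF (S : C) : simple S -> simple (F S).
  move=> /invF; exact: (tensorInvertible_simple (@ftc_rigid _ C') (ftc_bilinear C') simple1').
have nonprojF (S : C) : simple S -> ~ projective (F S).
  by move=> /invF; apply: invertible_nonprojective.
have faiF : faithful F.
  by apply: (exact_faithful F_lin F_exact lenl) => S /simpleF[].
have fulF : full F.
  apply: (full_of_simple F_lin F_exact projF enoughC lenl faiF injC).
    exact: (stable_faithful eqvF).
  move=> S T sS sT; apply: (stable_full_simple eqvF); [exact: simpleF..|exact: nonprojF].
apply: ff_equivalence => //.
apply: (essSurj_of_simple F_lin F_exact projF enoughC lenl') => // T sT.
apply: (simple_image eqvF) => //.
  exact: (simple_not_stably_zero enoughC injC lenl).
by apply: invertible_nonprojective C'_nss (invertibleW (C'_inv T sT)).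
Qed.
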